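(* Let $M\geq 12$ be an integer and let $G$ be a planar graph with maximum degree $\Delta\leq M$. Then $\lambda_2^T(G)\leq M+2$. In particular, $\lambda_2^T(G)\leq\Delta+2$ if $M=\Delta$.
   Context: All graphs are finite, simple and undirected. For a positive integer $k$, a $k$-(2,1)-total labelling of a graph $G$ is a function $c: V(G)\cup E(G)\to\{0,1,\dots,k\}$ such that $c(u)\neq c(v)$ whenever $uv\in E(G)$; $c(e)\neq c(e')$ whenever $e$ and $e'$ are two adjacent edges (distinct edges sharing an endpoint); and $|c(u)-c(e)|\geq 2$ whenever the vertex $u$ is incident with the edge $e$. The (2,1)-total labelling number $\lambda_2^T(G)$ is the minimum $k$ such that $G$ has a $k$-(2,1)-total labelling. *)

(* Defs.v *)
From HB Require Import structures.
From mathcomp Require Import all_boot all_order all_algebra zify.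

Set Implicit Arguments.
Unset Strict Implicit.
Unset Printing Implicit Defensive.

Record sgraph := SGraph {
  vertex :> finType;
  adj : rel vertex;
  adj_sym : symmetric adj;
  adj_irrefl : irreflexive adj }.

Definition edge_set (G : sgraph) : {set {set G}} :=
  [set [set u; v] | u in G, v in G & adj u v].

Definition edge (G : sgraph) : finType := {e : {set G} | e \in edge_set G}.

Definition incident (G : sgraph) (u : G) (e : edge G) : bool := u \in val e.

Definition adj_edges (G : sgraph) (e f : edge G) : bool :=
  (e != f) && [exists u : G, incident u e && incident u f].

Definition degree (G : sgraph) (u : G) : nat := #|[set v : G | adj u v]|.

Definition max_degree (G : sgraph) : nat := (\max_(u : G) degree u)%N.

Definition is_total_labelling (G : sgraph) (k : nat)
    (c : {ffun G + edge G -> 'I_k.+1}) : bool :=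
  [&& [forall u : G, forall v : G, adj u v ==> (c (inl u) != c (inl v))],
      [forall e : edge G, forall f : edge G,
         adj_edges e f ==> (c (inr e) != c (inr f))]
    & [forall u : G, forall e : edge G,
         incident u e ==> (2 <= `|c (inl u) - c (inr e)|)%N]].

Definition total_labellable (G : sgraph) (k : nat) : bool :=
  (0 < k)%N && [exists c : {ffun G + edge G -> 'I_k.+1}, is_total_labelling c].

Lemma total_labellable_ex (G : sgraph) : exists k, total_labellable G k.
Proof.
exists (#|G| + #|edge G|).+1; apply/andP; split=> //; apply/existsP.
pose c (x : G + edge G) : nat :=
  match x with inl u => enum_rank u | inr e => (#|G| + enum_rank e).+1 end.
have cE x : (c x < (#|G| + #|edge G|).+2)%N.
  case: x => [u|e] /=; last by rewrite !ltnS leq_add2l ltnW ?ltn_ord.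
  by rewrite ltnW // !ltnS (leq_trans (ltnW (ltn_ord _))) // leq_addr.
exists [ffun x => Ordinal (cE x)]; apply/and3P; split.
- apply/forallP=> u; apply/forallP=> v; apply/implyP=> uv.
  rewrite !ffunE; apply/eqP=> /(congr1 val) /= /val_inj /enum_rank_inj E.
  by rewrite E adj_irrefl in uv.
- apply/forallP=> e; apply/forallP=> f; apply/implyP=> /andP[/eqP ef _].
  rewrite !ffunE; apply/eqP=> /(congr1 val) /= E.
  by apply: ef; apply/enum_rank_inj/val_inj/(@addnI #|G|)/succn_inj.
- apply/forallP=> u; apply/forallP=> e; apply/implyP=> _.
  rewrite !ffunE /=; have := ltn_ord (enum_rank u).
  move: (nat_of_ord (enum_rank u)) (nat_of_ord (enum_rank e)) => a b.
  by rewrite -[#|_|]/#|G|; move: #|G| => n; lia.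
Qed.

Definition total_labelling_number (G : sgraph) : nat :=
  ex_minn (total_labellable_ex G).

From mathcomp Require Import all_classical all_reals all_analysis.
Import numFieldNormedType.Exports.

Local Open Scope classical_set_scope.
Local Open Scope ring_scope.

                                                                             
                                                                     
Definition plane_drawing (R : realType) (G : sgraph)
    (p : G -> R * R) (g : edge G -> R -> R * R) : Prop :=
  [/\ injective p,
      forall e, {within `[0, 1], continuous (g e)} /\
                {in `[0, 1] &, injective (g e)},
      forall e, [set g e 0; g e 1] = [set p u | u in [set u | incident u e]],
      forall e u (t : R), t \in `]0, 1[ -> g e t <> p u
    & forall e f (s t : R), e != f -> s \in `]0, 1[ -> t \in `]0, 1[ ->
        g e s <> g f t].

Definition planar (R : realType) (G : sgraph) : Prop :=
  exists (p : G -> R * R) (g : edge G -> R -> R * R), plane_drawing p g.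

(* Main.v *)
Require Import Defs.
From mathcomp Require Import all_boot all_order all_algebra zify lra.
From mathcomp Require boolp.

(** Why the bound holds.

    Only two consequences of planarity are used: a planar graph on n >= 3
    vertices has at most 3n - 6 edges, and at most 2n - 4 if it is bipartite.
    Neither is obtained from faces.  A drawing yields an even drawing: to a
    vertex a and an edge cd avoiding a one attaches the parity of the number of
    times the direction from a to a point running along cd crosses the negative
    horizontal axis.  For disjoint edges ab and cd the direction from a point of
    ab to a point of cd is never undefined, so its total turning along the
    boundary of the square of parameters vanishes; read modulo 2, this is a
    linear relation between the four parities of ab and cd and the lexicographic
    order of a, b, c, d ([adj_evenly_drawable]).  Such systems of parities, the
    van Kampen obstruction of Hanani and Tutte, pass to subgraphs and
    contractions, and adding up the relations of K5 or of K3,3 gives 0 = 1.  So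
    every minor of the graph avoids K5 and K3,3, and minimal counterexamples to
    the two density bounds are excluded by contraction ([evenly_drawable_arcs],
    [evenly_drawable_bipartite_arcs]).

    The colouring part takes a counterexample G with fewest edges.  Deleting
    edges at a vertex u of small degree and relabelling u together with these
    edges shows: a neighbour of a vertex of degree at most 3 has degree at least
    M - 1; a neighbour of a 4-vertex has degree at least 8; a 5-vertex with fewer
    than three neighbours of degree at least 8 has its other neighbours of degree
    exactly 7.  Deleting many vertices of degree at most 3 at once and
    relabelling their edges by Galvin's theorem on lists of bipartite graphs
    bounds the number of these vertices by the sum of max (deg y + 2 - M, 0) over
    all y ([alternator_bound]).

    Let n3, n4 be the numbers of vertices of degree 1 to 3 and of degree 4, h
    the number of vertices of degree at least 8, d the sum of deg v - 8 over
    them, w the number of 7-vertices, g and u the numbers of 5-vertices with at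
    least three, respectively fewer, neighbours of degree at least 8, and s the
    degree sum of the vertices counted by n3.  The density bound on the vertices
    of degree at least 4 gives w + d + 2h < s + 2 n4 + g + u.  The bipartite
    bound between the low vertices and those of degree at least 8 gives
    s + 2 n4 + g <= 2 n3 + 2h; after the u remaining 5-vertices are added to one
    side and the 7-vertices to the other it gives
    s + 2 n4 + g + 3u <= 2 n3 + 2h + 2w.  Since 2 n3 <= d by the alternator
    bound, the first two yield w < u and the first and third 2u < w. *)

Set Implicit Arguments.
Unset Strict Implicit.
Unset Printing Implicit Defensive.

(** * Even drawings and their minors *)

(** The relations of the edges ux and vx, added up, give the relation of the path
    uxv: the terms at x cancel. *)
Lemma xor_glue (p1 p2 q1 q2 c d x r1 r2 s1 s2 t u : bool) :
  p1 (+) q1 (+) c (+) x = r1 (+) t (+) s1 (+) u ->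
  p2 (+) q2 (+) d (+) x = r2 (+) t (+) s2 (+) u ->
  (p1 (+) p2) (+) (q1 (+) q2) (+) c (+) d = r1 (+) r2 (+) s1 (+) s2.
Proof.
pose S1 := p1 + q1 + c + x + (r1 + t + s1 + u).
pose S2 := p2 + q2 + d + x + (r2 + t + s2 + u).
pose S3 := (p1 + p2) + (q1 + q2) + c + d + (r1 + r2 + s1 + s2).
have xorE A B : (A == B) = ~~ (A (+) B) by rewrite negb_add.
move=> /eqP + /eqP + ; rewrite !xorE => H1 H2; apply/eqP; rewrite xorE.
have {}H1 : ~~ odd S1 by rewrite !oddD !oddb.
have {}H2 : ~~ odd S2 by rewrite !oddD !oddb.
have E : S1 + S2 = S3 + (x + t + u).*2.
  rewrite /S1 /S2 /S3; clear; do ![move: (nat_of_bool _) => ?]; lia.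
suff : ~~ odd S3 by rewrite !oddD !oddb.
have := congr1 odd E; rewrite oddD [RHS]oddD odd_double addbF => <-.
by move: (odd S1) (odd S2) H1 H2 => [] [].
Qed.

Section EvenDrawing.
Variable V : finType.
Implicit Types (adj : rel V).

(** The bit [n a u v] stands for the parity of the crossings of the edge uv with
    a horizontal ray from a, and [lt] for the order of the vertices by height. *)
Definition even_drawing adj (lt : rel V) (n : V -> V -> V -> bool) : Prop :=
  [/\ forall a b, a != b -> lt a b = ~~ lt b a,
      forall a u v, n a u v = n a v u
    & forall a b c d, uniq [:: a; b; c; d] -> adj a b -> adj c d ->
        n a c d (+) n b c d (+) n c a b (+) n d a b
        = lt a c (+) lt a d (+) lt b c (+) lt b d].

Definition evenly_drawable adj : Prop :=
  [/\ symmetric adj, irreflexive adj & exists lt n, even_drawing adj lt n].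

Lemma evenly_drawable_sub adj adj' :
  symmetric adj' -> subrel adj' adj -> evenly_drawable adj -> evenly_drawable adj'.
Proof.
move=> sym' sub [_ irr [lt [n [ltN nC nE]]]]; split=> //.
  by move=> u; apply/negP=> /sub; rewrite irr.
by exists lt, n; split=> // a b c d abcd /sub ab /sub cd; apply: nE.
Qed.

(** The merged vertex keeps the name y; x stays in the vertex type as an
    isolated vertex, so that all minors live on the same type. *)
Definition contract adj (x y : V) : rel V := fun u v =>
  [&& u != x, v != x, u != v
    & [|| adj u v, (u == y) && adj v x | (v == y) && adj u x]].

Lemma contract_sym adj x y : symmetric adj -> symmetric (contract adj x y).
Proof.
move=> sym u v; rewrite /contract (sym u v) (eq_sym u v).
by do 3!case: (_ != _); rewrite ?andbF //= [X in _ || X]orbC.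
Qed.

(** An edge that arises from the contraction is drawn along its path through x,
    so its parities are sums over the two edges of the path. *)
Lemma evenly_drawable_contract adj x y :
  adj x y -> evenly_drawable adj -> evenly_drawable (contract adj x y).
Proof.
move=> xy [sym irr [lt [n [ltN nC nE]]]]; split.
- exact: contract_sym.
- by move=> u; rewrite /contract eqxx !andbF.
exists lt, (fun a u v => if adj u v then n a u v else n a u x (+) n a v x).
split=> //= [a u v|a b c d abcd].
  by rewrite sym; case: ifP => // _; rewrite ?(nC _ u v) // addbC.
have path_via u v : contract adj x y u v -> adj u v = false -> adj u x /\ adj v x.
  rewrite /contract => /and4P[_ _ _] + uv; rewrite uv /=.
  by case/orP=> /andP[/eqP -> ->]; rewrite 1?(sym y x).
have avoid u v : contract adj x y u v -> (u != x) && (v != x).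
  by case/and4P=> -> ->.
have one_end u v : contract adj x y u v -> adj u v = false -> (u == y) || (v == y).
  by case/and4P=> _ _ _ + uv; rewrite uv /= => /orP[]/andP[->]; rewrite ?orbT.
move=> ab cd.
have /andP[ax bx] := avoid _ _ ab; have /andP[cx dx] := avoid _ _ cd.
move: abcd; rewrite /= !inE !negb_or !andbT => /and3P[/and3P[nab nac nad] /andP[nbc nbd] ncd].
case Eab: (adj a b); case Ecd: (adj c d).
- by apply: nE => //=; rewrite !inE !negb_or nab nac nad nbc nbd ncd.
- have [cX dX] := path_via _ _ cd Ecd.
  have H1 : uniq [:: a; b; c; x] by rewrite /= !inE !negb_or nab nac nbc ax bx cx.
  have H2 : uniq [:: a; b; d; x] by rewrite /= !inE !negb_or nab nad nbd ax bx dx.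
  exact: xor_glue (nE _ _ _ _ H1 Eab cX) (nE _ _ _ _ H2 Eab dX).
- have [aX bX] := path_via _ _ ab Eab.
  have H1 : uniq [:: a; x; c; d].
    by rewrite /= !inE !negb_or nac nad ncd ax !(eq_sym x) cx dx.
  have H2 : uniq [:: b; x; c; d].
    by rewrite /= !inE !negb_or nbc nbd ncd bx !(eq_sym x) cx dx.
  have {}H1 := nE _ _ _ _ H1 aX Ecd; have {}H2 := nE _ _ _ _ H2 bX Ecd.
  rewrite [LHS](ACl (3*4*1*2)) [RHS](ACl (1*3*2*4)) /=.
  apply: (@xor_glue _ _ _ _ _ _ (n x c d) _ _ _ _ (lt x c) (lt x d)).
  + by rewrite [LHS](ACl (3*4*1*2)) [RHS](ACl (1*3*2*4)) in H1.
  + by rewrite [LHS](ACl (3*4*1*2)) [RHS](ACl (1*3*2*4)) in H2.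
- case/orP: (one_end _ _ ab Eab) (one_end _ _ cd Ecd) => /eqP Ey /orP[] /eqP Ey';
  by move: nac nad nbc nbd; rewrite Ey Ey' ?eqxx.
Qed.



Lemma odd5 x y z t u :
  odd x -> odd y -> odd z -> odd t -> odd u -> odd (x + y + z + t + u).
Proof. by rewrite !oddD => -> -> -> -> ->. Qed.

Lemma odd9 x1 x2 x3 y1 y2 y3 z1 z2 z3 :
  odd x1 -> odd x2 -> odd x3 -> odd y1 -> odd y2 -> odd y3 -> odd z1 -> odd z2 -> odd z3 ->
  odd (x1 + x2 + x3 + y1 + y2 + y3 + z1 + z2 + z3).
Proof. by rewrite !oddD => -> -> -> -> -> -> -> -> ->. Qed.

(** Each pair of the four vertices is compared by [lt] in two of the three
    perfect matchings of K4; the directions agree for three pairs and disagree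
    for the other three, which leaves an odd number. *)
Lemma even_drawing_quad lt n adj a b c d :
  even_drawing adj lt n -> uniq [:: a; b; c; d] ->
  adj a b -> adj a c -> adj a d -> adj b c -> adj b d -> adj c d ->
  odd (n a c d + n b c d + n c a b + n d a b
       + (n a b d + n c b d + n b a c + n d a c)
       + (n a b c + n d b c + n b a d + n c a d)).
Proof.
case=> ltN nC nE; rewrite /= !inE !negb_or !andbT.
case/and3P=> /and3P[nab nac nad] /andP[nbc nbd] ncd ab ac ad bc bd cd.
rewrite !oddD !oddb (nE a b c d) ?(nE a c b d) ?(nE a d b c) //=;
  rewrite ?inE ?negb_or ?nab ?nac ?nad ?nbc ?nbd ?ncd ?(eq_sym c b) ?(eq_sym d b) ?(eq_sym d c)
          ?nbc ?nbd ?ncd //.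
rewrite (ltN c b) 1?eq_sym // (ltN d b) 1?eq_sym // (ltN d c) 1?eq_sym //.
by do 6!case: (lt _ _).
Qed.

(** The analogue for the two perfect matchings of a 4-cycle; the comparisons
    across the bipartition remain. *)
Lemma even_drawing_square lt n adj a1 a2 b1 b2 :
  even_drawing adj lt n -> uniq [:: a1; a2; b1; b2] ->
  adj a1 b1 -> adj a1 b2 -> adj a2 b1 -> adj a2 b2 ->
  odd (n a1 a2 b2 + n b1 a2 b2 + n a2 a1 b1 + n b2 a1 b1
       + (n a1 a2 b1 + n b2 a2 b1 + n a2 a1 b2 + n b1 a1 b2)
       + (lt a1 b1 + lt a1 b2 + lt a2 b1 + lt a2 b2)).
Proof.
case=> ltN nC nE; rewrite /= !inE !negb_or !andbT.
case/and3P=> /and3P[naa n11 n12] /andP[n21 n22] nbb e11 e12 e21 e22.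
rewrite !oddD !oddb (nE a1 b1 a2 b2) ?(nE a1 b2 a2 b1) //=;
  rewrite ?inE ?negb_or ?naa ?n11 ?n12 ?n21 ?n22 ?nbb ?(eq_sym b1 a2) ?(eq_sym b2 a2)
    ?(eq_sym b2 b1) ?n21 ?n22 ?nbb //.
rewrite (ltN b1 a2) 1?eq_sym // (ltN b2 a2) 1?eq_sym // (ltN b2 b1) 1?eq_sym //.
by do 6!case: (lt _ _).
Qed.

(** The five K4 of K5 give an odd total, but each parity term occurs twice. *)
Lemma even_drawing_K5 adj a b c d e :
  evenly_drawable adj -> uniq [:: a; b; c; d; e] ->
  [&& adj a b, adj a c, adj a d, adj a e & adj b c] ->
  [&& adj b d, adj b e, adj c d, adj c e & adj d e] -> False.
Proof.
case=> _ _ [lt [n drawn]] U /and5P[ab ac ad ae bc] /and5P[bd be cd ce de].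
have quad u1 u2 u3 u4 : uniq [:: u1; u2; u3; u4] -> _ :=
  @even_drawing_quad _ _ _ _ _ _ _ drawn.
have Qabcd := quad a b c d (mask_uniq U [:: true; true; true; true; false]) ab ac ad bc bd cd.
have Qabce := quad a b c e (mask_uniq U [:: true; true; true; false; true]) ab ac ae bc be ce.
have Qabde := quad a b d e (mask_uniq U [:: true; true; false; true; true]) ab ad ae bd be de.
have Qacde := quad a c d e (mask_uniq U [:: true; false; true; true; true]) ac ad ae cd ce de.
have Qbcde := quad b c d e (mask_uniq U [:: false; true; true; true; true]) bc bd be cd ce de.
have E : odd (
    n c a b + n d a b + n e a b + n b a c + n d a c + n e a c +
    n b a d + n c a d + n e a d + n b a e + n c a e + n d a e +
    n a b c + n d b c + n e b c + n a b d + n c b d + n e b d +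
    n a b e + n c b e + n d b e + n a c d + n b c d + n e c d +
    n a c e + n b c e + n d c e + n a d e + n b d e + n c d e).*2.
  have := odd5 Qabcd Qabce Qabde Qacde Qbcde.
  congr (odd _); clear; do ![move: (nat_of_bool _) => ?]; lia.
by rewrite odd_double in E.
Qed.

(** The nine 4-cycles of K3,3 give an odd total, but each parity term occurs
    twice and each comparison four times. *)
Lemma even_drawing_K33 adj a1 a2 a3 b1 b2 b3 :
  evenly_drawable adj -> uniq [:: a1; a2; a3; b1; b2; b3] ->
  [&& adj a1 b1, adj a1 b2 & adj a1 b3] -> [&& adj a2 b1, adj a2 b2 & adj a2 b3] ->
  [&& adj a3 b1, adj a3 b2 & adj a3 b3] -> False.
Proof.
case=> _ _ [lt [n drawn]] U /and3P[a1b1 a1b2 a1b3] /and3P[a2b1 a2b2 a2b3].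
case/and3P=> a3b1 a3b2 a3b3.
have square u1 u2 v1 v2 : uniq [:: u1; u2; v1; v2] -> _ :=
  @even_drawing_square _ _ _ _ _ _ _ drawn.
have Qa1a2b1b2 := square a1 a2 b1 b2 (mask_uniq U [:: true; true; false; true; true; false]) a1b1 a1b2 a2b1 a2b2.
have Qa1a2b1b3 := square a1 a2 b1 b3 (mask_uniq U [:: true; true; false; true; false; true]) a1b1 a1b3 a2b1 a2b3.
have Qa1a2b2b3 := square a1 a2 b2 b3 (mask_uniq U [:: true; true; false; false; true; true]) a1b2 a1b3 a2b2 a2b3.
have Qa1a3b1b2 := square a1 a3 b1 b2 (mask_uniq U [:: true; false; true; true; true; false]) a1b1 a1b2 a3b1 a3b2.
have Qa1a3b1b3 := square a1 a3 b1 b3 (mask_uniq U [:: true; false; true; true; false; true]) a1b1 a1b3 a3b1 a3b3.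
have Qa1a3b2b3 := square a1 a3 b2 b3 (mask_uniq U [:: true; false; true; false; true; true]) a1b2 a1b3 a3b2 a3b3.
have Qa2a3b1b2 := square a2 a3 b1 b2 (mask_uniq U [:: false; true; true; true; true; false]) a2b1 a2b2 a3b1 a3b2.
have Qa2a3b1b3 := square a2 a3 b1 b3 (mask_uniq U [:: false; true; true; true; false; true]) a2b1 a2b3 a3b1 a3b3.
have Qa2a3b2b3 := square a2 a3 b2 b3 (mask_uniq U [:: false; true; true; false; true; true]) a2b2 a2b3 a3b2 a3b3.
have E : odd (
    n a2 a1 b1 + n a3 a1 b1 + n b2 a1 b1 + n b3 a1 b1 + n a2 a1 b2 + n a3 a1 b2 +
    n b1 a1 b2 + n b3 a1 b2 + n a2 a1 b3 + n a3 a1 b3 + n b1 a1 b3 + n b2 a1 b3 +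
    n a1 a2 b1 + n a3 a2 b1 + n b2 a2 b1 + n b3 a2 b1 + n a1 a2 b2 + n a3 a2 b2 +
    n b1 a2 b2 + n b3 a2 b2 + n a1 a2 b3 + n a3 a2 b3 + n b1 a2 b3 + n b2 a2 b3 +
    n a1 a3 b1 + n a2 a3 b1 + n b2 a3 b1 + n b3 a3 b1 + n a1 a3 b2 + n a2 a3 b2 +
    n b1 a3 b2 + n b3 a3 b2 + n a1 a3 b3 + n a2 a3 b3 + n b1 a3 b3 + n b2 a3 b3 +
    2 * (lt a1 b1 + lt a1 b2 + lt a1 b3 + lt a2 b1 + lt a2 b2 + lt a2 b3 + lt a3 b1 + lt a3 b2 + lt a3 b3)).*2.
  have := odd9 Qa1a2b1b2 Qa1a2b1b3 Qa1a2b2b3 Qa1a3b1b2 Qa1a3b1b3 Qa1a3b2b3 Qa2a3b1b2 Qa2a3b1b3 Qa2a3b2b3.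
  congr (odd _); clear; do ![move: (nat_of_bool _) => ?]; lia.
by rewrite odd_double in E.
Qed.

End EvenDrawing.

(** * Edge density of evenly drawable graphs *)

Section Density.
Variable V : finType.
Implicit Types (adj : rel V) (S : {set V}).

Definition nbrs adj S v : {set V} := [set u in S | adj v u].
(** Ordered adjacent pairs, that is, twice the number of edges inside S. *)
Definition arcs adj S : nat := \sum_(v in S) #|nbrs adj S v|.

Lemma in_nbrs adj S v u : (u \in nbrs adj S v) = (u \in S) && adj v u.
Proof. by rewrite inE. Qed.

Lemma sum_setU (A B : {set V}) (F : V -> nat) : [disjoint A & B] ->
  \sum_(v in A :|: B) F v = \sum_(v in A) F v + \sum_(v in B) F v.
Proof. by move=> AB; rewrite -bigU //; apply: eq_bigl => v; rewrite !inE. Qed.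

Lemma card_nbrs_lt adj S v : irreflexive adj -> v \in S -> #|nbrs adj S v| < #|S|.
Proof.
move=> irr vS; apply/proper_card/properP; split.
  by apply/subsetP => u; rewrite inE => /andP[].
by exists v; rewrite // inE irr andbF.
Qed.

Lemma nbrsD1 adj S x v : x \in S -> #|nbrs adj S v| = adj v x + #|nbrs adj (S :\ x) v|.
Proof.
move=> xS; rewrite (cardsD1 x) in_nbrs xS /=; congr (_ + #|pred_of_set _|).
by apply/setP => u; rewrite !inE; case: (u == x).
Qed.

Lemma sum_adj adj S v : \sum_(u in S) adj v u = #|nbrs adj S v|.
Proof. by rewrite -big_mkcondr sum1dep_card; apply: eq_card => u; rewrite !inE. Qed.

Lemma arcsD1 adj S x : symmetric adj -> irreflexive adj -> x \in S ->
  arcs adj S = arcs adj (S :\ x) + 2 * #|nbrs adj S x|.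
Proof.
move=> sym irr xS; rewrite /arcs (big_setD1 x) //=.
under eq_bigr => v _ do rewrite (@nbrsD1 adj S x v) // sym.
rewrite big_split /= sum_adj; have := @nbrsD1 adj S x x xS; rewrite irr; lia.
Qed.

Definition del_edge adj x y : rel V := fun u v =>
  adj u v && ~~ [|| (u == x) && (v == y) | (u == y) && (v == x)].

Lemma del_edge_drawable adj x y : evenly_drawable adj -> evenly_drawable (del_edge adj x y).
Proof.
move=> E; apply: evenly_drawable_sub (E) => [u v|u v /andP[] //].
by case: E => sym _ _; rewrite /del_edge sym orbC; do 4 case: (_ == _).
Qed.

Lemma arcs_del_edge adj S x y : symmetric adj -> irreflexive adj ->
  x \in S -> y \in S -> adj x y -> arcs adj S = (arcs (del_edge adj x y) S).+2.
Proof.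
move=> sym irr xS yS xy.
have nxy : y != x by apply: contraTneq xy => ->; rewrite irr.
have ySx : y \in S :\ x by rewrite !inE nxy.
rewrite /arcs !(big_setD1 x xS) !(big_setD1 y ySx) /=.
have Ex : #|nbrs adj S x| = #|nbrs (del_edge adj x y) S x|.+1.
  rewrite (cardsD1 y) in_nbrs yS xy; congr _.+1; apply: eq_card => u.
  rewrite !inE /del_edge eqxx (eq_sym x y) (negPf nxy) /= orbF.
  by rewrite andbC -andbA.
have Ey : #|nbrs adj S y| = #|nbrs (del_edge adj x y) S y|.+1.
  rewrite (cardsD1 x) in_nbrs xS sym xy; congr _.+1; apply: eq_card => u.
  rewrite !inE /del_edge eqxx (negPf nxy) /=.
  by rewrite andbC -andbA.
rewrite Ex Ey; set s1 := \sum_(i in _) _; set s2 := \sum_(i in _) _.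
suff -> : s1 = s2 by lia.
apply: eq_bigr => v; rewrite !inE => /and3P[vy vx _]; apply: eq_card => u.
by rewrite !inE /del_edge (negPf vy) (negPf vx) andbT.
Qed.

(** Contracting xy loses that edge and merges edges in pairs exactly at the
    common neighbours of x and y. *)
Lemma arcs_contract adj S x y : symmetric adj -> irreflexive adj ->
  x \in S -> y \in S -> x != y ->
  arcs adj S <= arcs (contract adj x y) (S :\ x)
                + 2 * (adj x y + #|nbrs adj S x :&: nbrs adj S y|).
Proof.
move=> sym irr xS yS nxy.
have ySx : y \in S :\ x by rewrite !inE eq_sym nxy.
set c := #|_ :&: _|.
rewrite /arcs (big_setD1 x xS) (big_setD1 y ySx) [X in _ <= X + _](big_setD1 y ySx) /=.
set s1 := \sum_(i in _) _; set s2 := \sum_(i in _) _.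
(* The neighbours of x become neighbours of y; x and y themselves drop out. *)
have le_y : #|nbrs adj S x| + #|nbrs adj S y| <= #|nbrs (contract adj x y) (S :\ x) y| + 2 * adj x y + c.
  rewrite -cardsUI leq_add2r.
  have : nbrs adj S x :|: nbrs adj S y \subset
     nbrs (contract adj x y) (S :\ x) y :|: (if adj x y then [set x; y] else set0).
    apply/subsetP => u; rewrite !inE /contract eqxx /= (eq_sym y x) nxy /=.
    case: (u =P x) => [->|_].
      by rewrite irr !andbF /= => /andP[_]; rewrite sym => ->; rewrite !inE eqxx.
    rewrite (eq_sym y u); case: (u =P y) => [->|_] /=.
      by rewrite irr andbF orbF => /andP[_ ->]; rewrite !inE eqxx !orbT.
    rewrite orbF (sym u x); case: (u \in S) => //=.
    by case: (adj y u); case: (adj x u).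
  move=> /subset_leq_card /leq_trans -> //.
  rewrite (leq_trans (leq_card_setU _ _)) // leq_add2l.
  by case: (adj x y); rewrite ?cards0 // cards2 nxy.
have le_s : s1 <= s2 + c.
  have -> : c = \sum_(v in S :\ x :\ y) (adj v x && adj v y).
    rewrite -big_mkcondr sum1dep_card; apply: eq_card => u.
    rewrite !inE (sym u x) (sym u y); case: (u =P x) => [->|_]; first by rewrite irr !andbF.
    case: (u =P y) => [->|_]; first by rewrite irr !andbF.
    by rewrite /=; case: (u \in S).
  rewrite -big_split /=; apply: leq_sum => v; rewrite !inE => /and3P[vy vx vS].
  rewrite (@nbrsD1 adj S x) // (@nbrsD1 adj (S :\ x) y) //.
  have Ec : contract adj x y v y = adj v y || adj v x.
    by rewrite /contract vx (eq_sym y x) nxy vy eqxx (negPf vy).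
  rewrite (@nbrsD1 (contract adj x y) (S :\ x) y) // Ec.
  have : #|nbrs adj (S :\ x :\ y) v| <= #|nbrs (contract adj x y) (S :\ x :\ y) v|.
    apply/subset_leq_card/subsetP=> u; rewrite !inE /contract vx => /andP[/and3P[-> -> ->] uv].
    rewrite uv /= andbT; apply: contraTneq uv => ->; by rewrite irr.
  by case: (adj v x); case: (adj v y) => /=; clear; lia.
lia.
Qed.

(** On at most five vertices, minimum degree three forces a K4 minor, which v
    completes to a K5 minor. *)
Lemma evenly_drawable_no_dense_nbhd adj (v : V) (N : {set V}) :
  evenly_drawable adj -> (forall u, u \in N -> adj v u) ->
  0 < #|N| <= 5 -> (forall u, u \in N -> 2 < #|nbrs adj N u|) -> False.
Proof.
move=> drawn vN /andP[N_gt0 N_le5] N3; have [sym irr _] := drawn.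
have vNe u : u \in N -> v != u.
  by move=> /vN vu; apply: contraTneq vu => ->; rewrite irr.
have adjNe u w : adj u w -> u != w.
  by move=> vu; apply: contraTneq vu => ->; rewrite irr.
have [/existsP[a /andP[aN /existsP[b /and3P[bN nab abN]]]]|] :=
  boolP [exists a, (a \in N) && [exists b, [&& b \in N, a != b & ~~ adj a b]]].
- set N' := N :\ a :\ b.
  have bNa : b \in N :\ a by rewrite !inE eq_sym nab.
  have cN' : #|N'| + 2 <= 5.
    by move: N_le5; rewrite (cardsD1 a) aN (cardsD1 b) bNa -/N'; clear; lia.
  have full x y : x \in N -> y \in N -> x != y -> ~~ adj x y -> N :\ x :\ y = N' ->
      forall u, u \in N' -> adj x u.
    move=> xN yN nxy xyN <- u uN'; apply: contraTT (N3 x xN) => xu.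
    rewrite -leqNgt (@leq_trans #|N :\ x :\ y :\ u|) //.
      apply/subset_leq_card/subsetP => w; rewrite !inE => /andP[-> xw].
      rewrite !andbT; apply/and3P; split.
      + by apply: contraNneq xu => <-.
      + by apply: contraNneq xyN => <-.
      + by rewrite eq_sym adjNe.
    have yNx : y \in N :\ x by rewrite !inE eq_sym nxy.
    by move: N_le5; rewrite (cardsD1 x) xN (cardsD1 y) yNx (cardsD1 u) uN'; clear; lia.
  have aN' := full a b aN bN nab abN erefl.
  have bN' : forall u, u \in N' -> adj b u.
    apply: (full b a) => //; rewrite 1?eq_sym // 1?sym //.
    by rewrite /N'; apply/setP => u; rewrite !inE; case: (u == a); case: (u == b).
  have N'E u : (u \in N') = [&& u != b, u != a & u \in N] by rewrite !inE.
  clearbody N'; clear full.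
  have no_triple x y z : x \in N' -> y \in N' -> z \in N' ->
      x != y -> x != z -> y != z -> adj x y -> False.
    move=> xN' yN' zN' nxy nxz nyz xy.
    (* Merging z into a supplies the missing adjacency between a and b. *)
    have za : adj z a by rewrite sym aN'.
    have N'N u : u \in N' -> [/\ u \in N, u != a & u != b].
      by rewrite N'E => /and3P[].
    have [[xN xa xb] [yN ya yb]] := (N'N _ xN', N'N _ yN').
    have [zN az bz] := N'N _ zN'; rewrite eq_sym in az; rewrite eq_sym in bz.
    have vz := vNe z zN.
    have keep u w : u != z -> w != z -> adj u w -> contract adj z a u w.
      by move=> uz wz uw; rewrite /contract uz wz uw (adjNe u w).
    apply: (@even_drawing_K5 _ _ v x a b y (evenly_drawable_contract za drawn)).
      rewrite /= !inE !negb_or !vNe //= xa xb nxy nab.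
      by rewrite (eq_sym a y) (eq_sym b y) ya yb.
    - by rewrite !keep ?vN ?vz // sym aN'.
    - have -> : contract adj z a a b by rewrite /contract az bz nab eqxx /= bN' // orbT.
      by rewrite !keep ?aN' ?bN' // sym bN'.
  have [x [y [z [[xN' yN' zN'] [nxy nyz nzx]]]]] :
      exists x y z, [/\ x \in N', y \in N' & z \in N'] /\ [/\ x != y, y != z & z != x].
    apply/card_gt2P; apply: leq_trans (N3 a aN) _; apply/subset_leq_card/subsetP => u.
    rewrite N'E in_nbrs => /andP[-> au]; rewrite (eq_sym u a) (adjNe _ _ au) !andbT.
    by apply: contraNneq abN => <-.
  have xN : x \in N by move: xN'; rewrite N'E => /and3P[].
  have := N3 x xN; rewrite ltnNge => /negP; apply.
  apply: leq_trans (_ : #|[set a; b]| <= 2); last by rewrite cards2 nab.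
  apply/subset_leq_card/subsetP => u; rewrite !inE => /andP[uN xu].
  apply: contraTT cN'; rewrite negb_or => /andP[ua ub].
  have uN' : u \in N' by rewrite N'E ua ub uN.
  have ux : u != x by rewrite eq_sym adjNe.
  have uy : u != y.
    apply: contraTneq xu => ->; apply/negP; apply: (no_triple x y z) => //.
    by rewrite eq_sym.
  have uz : u != z.
    apply: contraTneq xu => ->; apply/negP; apply: (no_triple x z y) => //.
      by rewrite eq_sym.
    by rewrite eq_sym.
  rewrite -ltnNge (cardsD1 x) xN' (cardsD1 y) !inE (eq_sym y) nxy yN'.
  rewrite (cardsD1 z) !inE nzx (eq_sym z) nyz zN' (cardsD1 u) !inE ux uy uz uN'.
  by clear; lia.
- rewrite negb_exists => /forallP all_adj.
  have full a b : a \in N -> b \in N -> a != b -> adj a b.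
    move=> aN bN nab; have := all_adj a; rewrite aN /= negb_exists => /forallP/(_ b).
    by rewrite bN nab /= negbK.
  have [a aN] : exists a, a \in N by apply/set0Pn; rewrite -card_gt0.
  have /card_gt2P[b [c [d [[]]]]] := N3 a aN.
  rewrite !inE => /andP[bN ab] /andP[cN ac] /andP[dN ad] [nbc ncd ndb].
  have nbd : b != d by rewrite eq_sym.
  apply: (@even_drawing_K5 _ _ v a b c d drawn).
  + by rewrite /= !inE !negb_or !vNe // (adjNe _ _ ab) (adjNe _ _ ac) (adjNe _ _ ad) nbc ncd nbd.
  + by rewrite !vN // ab.
  + by rewrite ac ad !full.
Qed.

(** Mader's argument: in a smallest violation every edge lies in three
    triangles, since contracting it would give a smaller violation; hence the
    neighbourhood of a vertex of degree at most five has minimum degree three. *)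
Theorem evenly_drawable_arcs adj S :
  evenly_drawable adj -> 2 < #|S| -> arcs adj S + 12 <= 6 * #|S|.
Proof.
have [k] := ubnP #|S|; elim: k adj S => // k IHk adj S; rewrite ltnS => le_k.
have [m] := ubnP (arcs adj S); elim: m adj => // m IHm adj.
rewrite ltnS => le_m drawn S3; have [sym irr _] := drawn.
rewrite leqNgt; apply/negP => dense.
have [ltS|leS] := ltnP (arcs adj S) (6 * #|S|); last first.
  have [/existsP[v /andP[vS]]|] := boolP [exists v, (v \in S) && (0 < #|nbrs adj S v|)].
    rewrite card_gt0 => /set0Pn[u]; rewrite in_nbrs => /andP[uS vu].
    have E := arcs_del_edge sym irr vS uS vu.
    have := IHm (del_edge adj v u); rewrite E in dense leS le_m.
    move=> /(_ (ltnW le_m) (del_edge_drawable _ _ drawn) S3); lia.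
  rewrite negb_exists => /forallP iso; move: leS; rewrite /arcs big1; first by lia.
  by move=> v vS; have := iso v; rewrite vS /= -eqn0Ngt => /eqP.
have S4 : 3 < #|S|.
  rewrite ltn_neqAle S3 andbT; apply: contraTneq dense => S_3; rewrite -leqNgt.
  rewrite -S_3 (@leq_add _ _ 6 12) // (@leq_trans (\sum_(v in S) 2)) //.
    by apply: leq_sum => v vS; have := card_nbrs_lt irr vS; rewrite -S_3.
  by rewrite sum_nat_const -S_3.
have [v vS v5] : exists2 v, v \in S & #|nbrs adj S v| <= 5.
  apply/exists_inP; apply: contraTT ltS; rewrite negb_exists_in => /forall_inP deg6.
  rewrite -leqNgt mulnC -sum_nat_const; apply: leq_sum => v /deg6.
  by rewrite -ltnNge.
have S'3 : 2 < #|S :\ v| by move: S4; rewrite (cardsD1 v) vS.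
have cS : #|S| = #|S :\ v|.+1 by rewrite (cardsD1 v) vS.
have v4 : 3 < #|nbrs adj S v|.
  rewrite ltnNge; apply/negP => v3.
  have E := arcsD1 sym irr vS.
  have := IHk adj (S :\ v); rewrite -cS => /(_ le_k drawn S'3); lia.
apply: (@evenly_drawable_no_dense_nbhd adj v (nbrs adj S v)) => //.
- by move=> u; rewrite in_nbrs => /andP[].
- by rewrite v5 andbT; apply: leq_trans v4.
move=> u; rewrite in_nbrs => /andP[uS vu].
have nvu : v != u by apply: contraTneq vu => ->; rewrite irr.
rewrite ltnNge; apply/negP => c2.
have := arcs_contract sym irr vS uS nvu.
have -> : nbrs adj S v :&: nbrs adj S u = nbrs adj (nbrs adj S v) u.
  by apply/setP => w; rewrite !inE; case: (w \in S).
rewrite vu => E.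
have := IHk (contract adj v u) (S :\ v); rewrite -cS.
move=> /(_ le_k (evenly_drawable_contract vu drawn) S'3); lia.
Qed.

End Density.

(** * Edge density of bipartite evenly drawable graphs *)

Section BipartiteDensity.
Variable V : finType.
Implicit Types (adj : rel V) (S : {set V}).

Definition edges_between adj (A B : {set V}) : bool :=
  [exists u in A, exists v in B, adj u v].

Lemma edges_betweenP adj (A B : {set V}) :
  reflect (exists u v, [/\ u \in A, v \in B & adj u v]) (edges_between adj A B).
Proof.
apply: (iffP exists_inP) => [[u uA /exists_inP[v vB uv]]|[u [v [uA vB uv]]]].
  by exists u, v.
by exists u => //; apply/exists_inP; exists v.
Qed.

(** Connectedness by cuts rather than by paths: it is this form that survives a
    contraction inside D. *)
Definition cut_connected adj (D : {set V}) : Prop :=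
  forall A : {set V}, A \proper D -> A != set0 -> edges_between adj A (D :\: A).

(** A smallest nonempty set that no edge leaves inside T is a component. *)
Lemma connected_piece adj (T : {set V}) : T != set0 ->
  exists D : {set V}, [/\ D \subset T, D != set0, ~~ edges_between adj D (T :\: D)
                        & cut_connected adj D].
Proof.
move=> T0; pose P (D : {set V}) := [&& D \subset T, D != set0 & ~~ edges_between adj D (T :\: D)].
have PT : P T.
  rewrite /P subxx T0; apply/negP => /edges_betweenP[u [v [_ + _]]].
  by rewrite setDv inE.
case: (@arg_minnP _ T P (fun D => #|D|) PT) => D /and3P[DT D0 DC] minD.
exists D; split=> // A AD A0; apply: contraT => noAD.
have : #|D| <= #|A|.
  apply: minD; rewrite /P A0 (subset_trans (proper_sub AD) DT) /=.
  apply: contra DC => /edges_betweenP[u [v [uA + uv]]].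
  rewrite inE => /andP[vA vT]; apply/edges_betweenP; exists u, v; split=> //.
    exact: (subsetP (proper_sub AD)).
  rewrite inE vT andbT; apply: contra noAD => vD; apply/edges_betweenP.
  by exists u, v; rewrite inE vA vD.
by rewrite leqNgt proper_card.
Qed.

(** The whole of D can be contracted to its vertex d, one edge at a time. *)
Lemma evenly_drawable_contract_set adj (D : {set V}) d :
  evenly_drawable adj -> d \in D -> cut_connected adj D ->
  exists adj', [/\ evenly_drawable adj',
    forall u v, u \notin D -> v \notin D -> adj u v -> adj' u v
    & forall u v, u \notin D -> v \in D -> adj u v -> adj' u d].
Proof.
have [k] := ubnP #|D|; elim: k adj D => // k IHk adj D; rewrite ltnS => le_k.
move=> drawn dD conD; have [sym irr _] := drawn.
have [/eqP D1|nD1] := boolP (D == [set d]).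
  by exists adj; split=> // u v _; rewrite D1 inE => /eqP->.
have /edges_betweenP[d' [x [+ + dx]]] : edges_between adj [set d] (D :\: [set d]).
  apply: conD; last by apply/set0Pn; exists d; rewrite inE.
  by rewrite properEneq eq_sym nD1 sub1set.
rewrite !inE => /eqP d'd /andP[nxd xD]; rewrite {d'}d'd in dx.
have xd : adj x d by rewrite sym.
pose adj1 := contract adj x d.
have adj1I u v : u != x -> v != x -> adj u v -> adj1 u v.
  move=> ux vx uv; rewrite /adj1 /contract ux vx uv andbT.
  by apply: contraTneq uv => ->; rewrite irr.
have adj1x u : u != x -> u != d -> adj u x -> adj1 u d.
  by move=> ux ud uxe; rewrite /adj1 /contract ux ud uxe eqxx (eq_sym d) nxd !orbT.
have [||||adj' [drawn' off to_d]] := IHk adj1 (D :\ x).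
- by rewrite (leq_trans _ le_k) // [X in _ < X](cardsD1 x) xD.
- exact: evenly_drawable_contract.
- by rewrite !inE eq_sym nxd.
- move=> A /properP[/subsetP AD [z]]; rewrite !inE => /andP[zx zD] zA A0.
  have Ax u : u \in A -> u != x by move/AD; rewrite !inE => /andP[].
  have ADD u : u \in A -> u \in D by move/AD; rewrite !inE => /andP[].
  pose B := if d \in A then x |: A else A.
  have BD : B \proper D.
    apply/properP; split; last first.
      by exists z => //; rewrite /B; case: ifP => // _; rewrite !inE negb_or zx.
    apply/subsetP => u; rewrite /B; case: ifP => _; last exact: ADD.
    by rewrite !inE => /orP[/eqP->|/ADD].
  have B0 : B != set0.
    by have /set0Pn[a aA] := A0; apply/set0Pn; exists a; rewrite /B; case: ifP; rewrite ?inE aA ?orbT.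
  have /edges_betweenP[u [v [uB + uv]]] := conD B BD B0.
  rewrite inE => /andP[vB vD]; apply/edges_betweenP.
  move: uB vB; rewrite /B; case: ifP => dA.
    rewrite !inE negb_or => /orP[/eqP ux|uA] /andP[vx vA].
      exists d, v; rewrite !inE dA vx vA vD; split=> //.
      have vd : v != d by apply: contraNneq vA => ->.
      have [sym1 _ _] := evenly_drawable_contract xd drawn.
      by rewrite -/adj1 in sym1; rewrite sym1 adj1x // sym -ux.
    by exists u, v; rewrite !inE vA vx vD uA adj1I // Ax.
  move=> uA vA; have [vx|nvx] := eqVneq v x.
    exists u, d; rewrite !inE dA eq_sym nxd dD uA; split=> //.
    apply: adj1x; rewrite ?Ax // -?vx //.
    by apply: contraFneq dA => <-.
  by exists u, v; rewrite !inE uA vA nvx vD adj1I // Ax.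
have D1D u : u \notin D -> (u \notin D :\ x) && (u != x).
  by move=> uD; rewrite !inE negb_and uD orbT; apply: contraNneq uD => ->.
exists adj'; split=> // [u v /D1D/andP[uD ux] /D1D/andP[vD vx] uv|u v uD vD uv].
  by apply: off => //; apply: adj1I.
have /andP[uD' ux] := D1D _ uD.
have [vx|nvx] := eqVneq v x.
  apply: (to_d u d) => //; first by rewrite !inE eq_sym nxd.
  apply: adj1x => //; last by rewrite -vx.
  by apply: contraNneq uD => ->.
by apply: (to_d u v) => //; [rewrite !inE nvx | apply: adj1I].
Qed.

(** A K3,3 minor in which only one branch set is not a single vertex. *)
Lemma even_drawing_K33_connected adj (D : {set V}) y1 y2 x1 x2 x3 :
  evenly_drawable adj -> cut_connected adj D -> D != set0 ->
  uniq [:: y1; y2; x1; x2; x3] ->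
  [disjoint D & [:: y1; y2; x1; x2; x3]] ->
  [&& adj y1 x1, adj y1 x2 & adj y1 x3] -> [&& adj y2 x1, adj y2 x2 & adj y2 x3] ->
  (forall x, x \in [:: x1; x2; x3] -> edges_between adj [set x] D) -> False.
Proof.
move=> drawn conD /set0Pn[d dD] U disD /and3P[e11 e12 e13] /and3P[e21 e22 e23] toD.
have [adj' [drawn' off to_d]] := evenly_drawable_contract_set drawn dD conD.
have [sym' irr' _] := drawn'.
have nD u : u \in [:: y1; y2; x1; x2; x3] -> u \notin D.
  by move=> uT; have := disjoint_sym D (mem [:: y1; y2; x1; x2; x3]); rewrite disD => /esym/disjointFr->.
have d_adj x : x \in [:: x1; x2; x3] -> adj' d x.
  move=> xT; have /edges_betweenP[x' [v [/set1P -> vD xv]]] := toD x xT.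
  rewrite sym'; apply: to_d vD xv; apply: nD.
  by rewrite !inE in xT *; rewrite xT !orbT.
have nd u : u \in [:: y1; y2; x1; x2; x3] -> u != d.
  by move/nD; apply: contraNneq => ->.
apply: (@even_drawing_K33 _ _ y1 y2 d x1 x2 x3 drawn').
- rewrite (perm_uniq (_ : perm_eq _ [:: d, y1, y2, x1, x2 & [:: x3]])).
    by rewrite cons_uniq U andbT; apply/negP => /nd; rewrite eqxx.
  exact/permPl/(perm_catCA [:: y1; y2] [:: d]).
- by rewrite !off // nD ?inE ?eqxx ?orbT.
- by rewrite !off // nD ?inE ?eqxx ?orbT.
- by rewrite !d_adj ?inE ?eqxx ?orbT.
Qed.


(** The edges inside C are counted on both sides; for a 4-cycle C this surplus
    pays for the additive constant in the bipartite bound. *)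
Lemma arcs_glue_square adj (C A B : {set V}) :
  [disjoint C & A] -> [disjoint C & B] -> [disjoint A & B] ->
  ~~ edges_between adj A B -> ~~ edges_between adj B A ->
  (forall u, u \in C -> 2 <= #|nbrs adj C u|) ->
  arcs adj (C :|: A :|: B) + 2 * #|C| <= arcs adj (C :|: A) + arcs adj (C :|: B).
Proof.
move=> CA CB AB noAB noBA C2.
have split_nbrs (X Y : {set V}) v : [disjoint X & Y] ->
    #|nbrs adj (X :|: Y) v| = #|nbrs adj X v| + #|nbrs adj Y v|.
  move=> XY; rewrite -cardsUI [X in _ = _ + X](_ : _ = 0) ?addn0.
    by apply: eq_card => u; rewrite !inE andb_orl.
  apply/eqP; rewrite cards_eq0 -subset0; apply/subsetP => u.
  by rewrite !inE => /andP[/andP[uX _] /andP[uY _]]; rewrite (disjointFr XY uX) in uY.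
have no_nbrs (X Y : {set V}) v : ~~ edges_between adj X Y -> v \in X -> #|nbrs adj Y v| = 0.
  move=> noXY vX; apply/eqP; rewrite cards_eq0 -subset0; apply/subsetP => u.
  rewrite !inE => /andP[uY vu]; case/negP: noXY; apply/edges_betweenP.
  by exists v, u.
have CAB : [disjoint C :|: A & B] by rewrite disjoints_subset subUset -!disjoints_subset CB AB.
rewrite /arcs !sum_setU //.
have -> : \sum_(i in A) #|nbrs adj (C :|: A :|: B) i| = \sum_(v in A) #|nbrs adj (C :|: A) v|.
  by apply: eq_bigr => v vA; rewrite split_nbrs // (no_nbrs A B) // addn0.
have -> : \sum_(v in B) #|nbrs adj (C :|: A :|: B) v| = \sum_(v in B) #|nbrs adj (C :|: B) v|.
  by apply: eq_bigr => v vB; rewrite !split_nbrs // (no_nbrs B A) // addn0.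
have : \sum_(v in C) #|nbrs adj (C :|: A :|: B) v| + 2 * #|C| <=
   \sum_(v in C) #|nbrs adj (C :|: A) v| + \sum_(v in C) #|nbrs adj (C :|: B) v|.
  rewrite mulnC -sum_nat_const -!big_split /=; apply: leq_sum => v vC.
  by rewrite !split_nbrs //; have := C2 v vC; lia.
clear; lia.
Qed.

Definition proper_on adj S (col : V -> bool) : Prop :=
  forall u v, u \in S -> v \in S -> adj u v -> col u != col v.

Lemma proper_arcs3 adj S col : irreflexive adj -> proper_on adj S col -> #|S| = 3 -> arcs adj S <= 4.
Proof.
move=> irr pr S3.
pose T := [set v in S | col v]; pose F := [set v in S | ~~ col v].
have TF : #|T| + #|F| = 3.
  rewrite -S3 -[in RHS](cardsID [set v | col v] S); congr (_ + _); apply: eq_card => v.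
    by rewrite !inE.
  by rewrite !inE andbC.
apply: (@leq_trans (\sum_(v in S) (if col v then #|F| else #|T|))).
  apply: leq_sum => v vS; case: ifP => cv; apply/subset_leq_card/subsetP => u.
    by rewrite !inE => /andP[uS vu]; rewrite uS; have := pr v u vS uS vu; rewrite cv; case: (col u).
  by rewrite !inE => /andP[uS vu]; rewrite uS; have := pr v u vS uS vu; rewrite cv; case: (col u).
rewrite (bigID col) /=.
rewrite (eq_bigr (fun=> #|F|)); last by move=> v /andP[_ ->].
rewrite [X in _ + X](eq_bigr (fun=> #|T|)); last by move=> v /andP[_ /negPf ->].
rewrite !sum_nat_cond_const.
have -> : #|[set v in S | col v]| = #|T| by [].
have -> : #|[set v in S | ~~ col v]| = #|F| by [].
by move: TF; clear; case: #|T| => [|[|[|[|?]]]]; case: #|F| => [|[|[|[|?]]]].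
Qed.

(** In a smallest violation all degrees are at least three and no 4-cycle
    separates.  Three common neighbours of y1 and y2 would then be joined to one
    component of the rest, giving K3,3.  So two vertices have at most two common
    neighbours, and contracting a path y v y' through a vertex v of degree three
    loses two vertices and at most four edges, hence is again a violation. *)
Theorem evenly_drawable_bipartite_arcs adj S col :
  evenly_drawable adj -> proper_on adj S col -> 2 < #|S| -> arcs adj S + 8 <= 4 * #|S|.
Proof.
have [k] := ubnP #|S|; elim: k adj S => // k IHk adj S; rewrite ltnS => le_k.
have [m] := ubnP (arcs adj S); elim: m adj => // m IHm adj.
rewrite ltnS => le_m drawn pr S3; have [sym irr _] := drawn.
rewrite leqNgt; apply/negP => dense.
have adjNe u w : adj u w -> u != w.
  by move=> vu; apply: contraTneq vu => ->; rewrite irr.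
have [ltS|leS] := ltnP (arcs adj S) (4 * #|S|); last first.
  have [/existsP[v /andP[vS]]|] := boolP [exists v, (v \in S) && (0 < #|nbrs adj S v|)].
    rewrite card_gt0 => /set0Pn[u]; rewrite in_nbrs => /andP[uS vu].
    have E := arcs_del_edge sym irr vS uS vu.
    have := IHm (del_edge adj v u); rewrite E in dense leS le_m.
    move=> /(_ (ltnW le_m) (del_edge_drawable _ _ drawn) _ S3).
    have prd : proper_on (del_edge adj v u) S col.
      by move=> u' v' u'S v'S /andP[u'v' _]; apply: pr.
    by move=> /(_ prd); clear - dense leS; lia.
  rewrite negb_exists => /forallP iso; move: leS; rewrite /arcs big1; first by clear -S3; lia.
  by move=> v vS; have := iso v; rewrite vS /= -eqn0Ngt => /eqP.
have S4 : 3 < #|S|.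
  rewrite ltn_neqAle S3 andbT; apply: contraTneq dense => S_3; rewrite -leqNgt -S_3.
  by have := proper_arcs3 irr pr (esym S_3); clear; lia.
have deg3 v : v \in S -> 2 < #|nbrs adj S v|.
  move=> vS; rewrite ltnNge; apply/negP => v2.
  have S'3 : 2 < #|S :\ v| by move: S4; rewrite (cardsD1 v) vS.
  have cS : #|S| = #|S :\ v|.+1 by rewrite (cardsD1 v) vS.
  have E := arcsD1 sym irr vS.
  have := IHk adj (S :\ v); rewrite -cS => /(_ le_k drawn _ S'3).
  have pr' : proper_on adj (S :\ v) col.
    by move=> u w; rewrite !inE => /andP[_ uS] /andP[_ wS]; apply: pr.
  by move=> /(_ pr'); clear -dense E v2 cS; lia.
(* A separating 4-cycle splits the graph into two smaller ones; by the induction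
   hypothesis for both, the bound would hold. *)
have no_sep (C A B : {set V}) : C :|: A :|: B = S -> #|C| = 4 ->
    [disjoint C & A] -> [disjoint C & B] -> [disjoint A & B] ->
    A != set0 -> B != set0 ->
    ~~ edges_between adj A B -> (forall u, u \in C -> 2 <= #|nbrs adj C u|) -> False.
  move=> SE C4 CA CB AB A0 B0 noAB C2.
  have noBA : ~~ edges_between adj B A.
    apply: contra noAB => /edges_betweenP[u [v [? ? ?]]]; apply/edges_betweenP.
    by exists v, u; rewrite sym.
  have := arcs_glue_square CA CB AB noAB noBA C2; rewrite SE C4.
  have cS : #|S| = 4 + #|A| + #|B|.
    by rewrite -SE !cardsU !disjoint_setI0 ?cards0 ?subn0 ?C4 // disjoints_subset subUset -!disjoints_subset CB AB.
  have cCA : #|C :|: A| = 4 + #|A| by rewrite cardsU disjoint_setI0 ?cards0 ?subn0 ?C4.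
  have cCB : #|C :|: B| = 4 + #|B| by rewrite cardsU disjoint_setI0 ?cards0 ?subn0 ?C4.
  rewrite -card_gt0 in A0; rewrite -card_gt0 in B0.
  have pr' (X : {set V}) : X \subset S -> proper_on adj X col.
    by move=> /subsetP XS u w /XS uS /XS wS; apply: pr.
  have := IHk adj (C :|: A); rewrite cCA.
  have := IHk adj (C :|: B); rewrite cCB.
  move=> /(_ _ drawn (pr' _ _) _) => H1 /(_ _ drawn (pr' _ _) _) H2 H3.
  have {}H1 := H1 ltac:(lia) ltac:(rewrite -SE -setUA setUCA subsetUr //) ltac:(lia).
  have {}H2 := H2 ltac:(lia) ltac:(rewrite -SE subsetUl //) ltac:(lia).
  by clear - H1 H2 H3 cS dense; lia.
have codeg y1 y2 : y1 \in S -> y2 \in S -> y1 != y2 ->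
    #|nbrs adj S y1 :&: nbrs adj S y2| <= 2.
  move=> y1S y2S ny; rewrite leqNgt; apply/negP => /card_gt2P[x1 [x2 [x3 [[]]]]].
  rewrite !inE => /andP[/andP[x1S e11] /andP[_ e21]].
  move=> /andP[/andP[x2S e12] /andP[_ e22]] /andP[/andP[x3S e13] /andP[_ e23]] [n12 n23 n31].
  have prN u w : u \in S -> w \in S -> col u = col w -> adj u w = false.
    by move=> uS wS E; apply/negP => /(pr _ _ uS wS); rewrite E eqxx.
  have colX x : x \in S -> adj y1 x -> col x = ~~ col y1.
    by move=> xS /(pr _ _ y1S xS); case: (col x); case: (col y1).
  have dy1 x : x \in S -> adj y1 x -> x != y1 by move=> _ /adjNe; rewrite eq_sym.
  have dy2 x : x \in S -> adj y2 x -> x != y2 by move=> _ /adjNe; rewrite eq_sym.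
  pose R := S :\: [set y1; y2; x1; x2; x3].
  have RE u : (u \in R) = [&& u \in S, u != y1, u != y2, u != x1, u != x2 & u != x3].
    by rewrite !inE !negb_or andbC -!andbA.
  have R0 : R != set0.
    apply/negP => /eqP R0; have := deg3 x1 x1S; rewrite ltnNge => /negP; apply.
    apply: leq_trans (_ : #|[set y1; y2]| <= 2); last by rewrite cards2; case: (_ != _).
    apply/subset_leq_card/subsetP => u; rewrite !inE => /andP[uS xu].
    have : u \notin R by rewrite R0 inE.
    rewrite RE uS /= !negb_and !negbK => /or4P[->//|->|/eqP E|]; rewrite ?orbT //.
      by rewrite E irr in xu.
    case/orP=> /eqP E; rewrite E prN // in xu.
      by rewrite (colX x2) // (colX x1).
    by rewrite (colX x3) // (colX x1).
  clearbody R.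
  have [D [DR D0 DC conD]] := connected_piece adj R0.
  have DRE u : u \in D -> u \in R by apply/subsetP.
  have touch x x' x'' : x \in S -> x' \in S -> x'' \in S ->
      adj y1 x -> adj y1 x' -> adj y1 x'' -> adj y2 x -> adj y2 x' -> adj y2 x'' ->
      x != x' -> x != x'' -> x' != x'' ->
      (forall u, (u \in R) = [&& u \in S, u != y1, u != y2, u != x, u != x' & u != x'']) ->
      edges_between adj [set x] D.
    move=> xS x'S x''S f1 f1' f1'' f2 f2' f2'' nx nx' nxx RE'.
    apply: contraT => noxD; exfalso.
    have DE u : u \in D -> [&& u \in S, u != y1, u != y2, u != x, u != x' & u != x''].
      by move/DRE; rewrite RE'.
    have CE u : (u \in [set y1; y2; x'; x'']) = [|| u == y1, u == y2, u == x' | u == x''].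
      by rewrite !inE -!orbA.
    apply: (no_sep [set y1; y2; x'; x''] D (x |: (R :\: D))) => //.
    - apply/setP => u; rewrite in_setU in_setU CE in_setU1 in_setD; have := DE u; rewrite RE'.
      case: (u =P y1) => [->|_]; first by rewrite y1S.
      case: (u =P y2) => [->|_]; first by rewrite y2S.
      case: (u =P x) => [->|_]; first by rewrite xS /= !orbT.
      case: (u =P x') => [->|_]; first by rewrite x'S.
      case: (u =P x'') => [->|_]; first by rewrite x''S.
      by rewrite !andbT /=; case: (u \in D) => // ->.
    - rewrite (@eq_card _ _ (mem [:: y1; y2; x'; x''])); last by move=> u; rewrite CE !inE.
      apply: (card_uniqP _); rewrite /= !inE !negb_or ny nxx !(eq_sym y1) !(eq_sym y2).
      by rewrite !dy1 ?dy2.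
    - rewrite disjoint_sym disjoints_subset; apply/subsetP => u /DE.
      by rewrite inE CE !negb_or => /and5P[_ -> -> _ /andP[-> ->]].
    - rewrite disjoint_sym disjoints_subset; apply/subsetP => u.
      rewrite 3!inE RE' inE CE !negb_or => /orP[/eqP->|/andP[_ /and5P[_ -> -> _ /andP[-> ->]]]] //.
      by rewrite (dy1 x) // (dy2 x) // nx nx'.
    - rewrite disjoints_subset; apply/subsetP => u uD.
      by rewrite !inE uD /= orbF; have /and5P[_ _ _ ->] := DE u uD.
    - by apply/set0Pn; exists x; rewrite !inE eqxx.
    - apply/negP => /edges_betweenP[u [w [uD]]]; rewrite inE => /orP[/set1P->|wR] uw.
        case/negP: noxD; apply/edges_betweenP; exists x, u; split=> //; first by rewrite inE.
        by rewrite sym.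
      by case/negP: DC; apply/edges_betweenP; exists u, w.
    - have two u a b : a != b -> a \in [set y1; y2; x'; x''] -> b \in [set y1; y2; x'; x''] ->
          adj u a -> adj u b -> 1 < #|nbrs adj [set y1; y2; x'; x''] u|.
        move=> nab aC bC ua ub; apply/card_gt1P; exists a, b.
        by rewrite !in_nbrs aC bC ua ub.
      move=> u; rewrite CE => /or4P[] /eqP->.
      + by apply: (two _ x' x''); rewrite ?CE ?eqxx ?orbT.
      + by apply: (two _ x' x''); rewrite ?CE ?eqxx ?orbT.
      + by apply: (two _ y1 y2); rewrite ?CE ?eqxx ?orbT // sym.
      + by apply: (two _ y1 y2); rewrite ?CE ?eqxx ?orbT // sym.
  apply: (@even_drawing_K33_connected adj D y1 y2 x1 x2 x3) => //.
  - rewrite /= !inE !negb_or ny n12 n23 (eq_sym x1 x3) n31.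
    by rewrite !(eq_sym y1) !(eq_sym y2) !(dy1, dy2).
  - rewrite disjoint_subset; apply/subsetP => u /DRE; rewrite RE !inE !negb_or.
    by case/and5P=> _ -> -> -> /andP[-> ->].
  - by rewrite e11 e12 e13.
  - by rewrite e21 e22 e23.
  have n13 : x1 != x3 by rewrite eq_sym.
  move=> x; rewrite !inE => /or3P[] /eqP->.
  - exact: (touch x1 x2 x3).
  - apply: (touch x2 x1 x3) => // [|u]; first by rewrite eq_sym.
    by rewrite RE; do 5 case: (u == _).
  - apply: (touch x3 x1 x2) => // [|u]; first by rewrite eq_sym.
    by rewrite RE; do 5 case: (u == _); rewrite ?andbF ?andbT.
have [v vS v3] : exists2 v, v \in S & #|nbrs adj S v| <= 3.
  apply/exists_inP; apply: contraTT ltS; rewrite negb_exists_in => /forall_inP deg4.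
  rewrite -leqNgt mulnC -sum_nat_const; apply: leq_sum => v /deg4.
  by rewrite -ltnNge.
have /card_gt1P[y [y' []]] := ltnW (deg3 v vS).
rewrite !in_nbrs => /andP[yS vy] /andP[y'S vy'] nyy'.
have col_y w : w \in S -> adj v w -> col w = ~~ col v.
  by move=> wS /(pr _ _ vS wS); case: (col w); case: (col v).
have nvy := adjNe _ _ vy; have nvy' := adjNe _ _ vy'.
(* Three neighbours of v and three of y, so two vertices can be spared. *)
have S6 : 6 <= #|S|.
  have -> : 6 = 3 + 3 by []; rewrite (leq_trans (leq_add (deg3 v vS) (deg3 y yS))) //.
  rewrite -cardsUI [X in _ + X](_ : _ = 0) ?addn0.
    by apply/subset_leq_card/subsetP => u; rewrite !inE => /orP[] /andP[].
  apply/eqP; rewrite cards_eq0 -subset0; apply/subsetP => u.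
  rewrite !inE => /andP[/andP[uS vu] /andP[_ yu]].
  by have := pr _ _ yS uS yu; rewrite (col_y u) // (col_y y) // eqxx.
pose G' : rel V := fun a b => [&& contract adj y' y a b, a != v & b != v].
have drawn' : evenly_drawable G'.
  have d1 := evenly_drawable_contract vy drawn.
  have y'y : contract adj v y y' y.
    by rewrite /contract !(eq_sym _ v) nvy nvy' (eq_sym y' y) nyy' eqxx (sym y' v) vy' !orbT.
  apply: evenly_drawable_sub (evenly_drawable_contract y'y d1) => a b.
    by rewrite /G' (contract_sym _ _ sym) [(a != v) && _]andbC.
  rewrite /G' /contract => /and3P[/and4P[-> -> -> adjs] av bv] /=.
  rewrite av bv /=.
  rewrite (eq_sym y' v) nvy' /=.
  case/or3P: adjs => [->|/andP[/eqP-> ->]|/andP[/eqP-> ->]] //=.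
  - by rewrite eqxx orbT.
  - by rewrite eqxx !orbT.
pose S2 := S :\ v :\ y'.
have S2E u : (u \in S2) = [&& u != y', u != v & u \in S] by rewrite !inE.
have y'Sv : y' \in S :\ v by rewrite !inE eq_sym nvy'.
have ySv : y \in S :\ v by rewrite !inE eq_sym nvy.
have cS2 : #|S| = #|S2|.+2 by rewrite (cardsD1 v) vS (cardsD1 y') y'Sv.
have pr2 : proper_on G' S2 col.
  move=> a b; rewrite !S2E => /and3P[ay' av aS] /and3P[by' bv bS].
  rewrite /G' av bv !andbT => /and4P[_ _ _ /or3P[|/andP[/eqP-> by'_]|/andP[/eqP-> ay'_]]].
  - exact: pr.
  - by rewrite (col_y y) // -(col_y y') // eq_sym; apply: pr.
  - by rewrite (col_y y) // -(col_y y') //; apply: pr.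
have ny'y : adj y' y = false.
  by apply/negP => /(pr _ _ y'S yS); rewrite (col_y y) // (col_y y') // eqxx.
have := codeg _ _ y'S yS; rewrite eq_sym nyy' => /(_ isT).
rewrite (cardsD1 v) !inE vS sym vy' sym vy /= add1n => cod.
have E1 := arcsD1 sym irr vS.
have := arcs_contract sym irr y'Sv ySv; rewrite eq_sym nyy' ny'y => /(_ isT) E2.
have E3 : nbrs adj (S :\ v) y' :&: nbrs adj (S :\ v) y = (nbrs adj S y' :&: nbrs adj S y) :\ v.
  by apply/setP => u; rewrite !inE; case: (u == v).
have E4 : arcs (contract adj y' y) S2 = arcs G' S2.
  apply: eq_bigr => a; rewrite S2E => /and3P[_ av _]; apply: eq_card => b.
  rewrite !in_nbrs S2E /G' av /=; case: (b != v); rewrite ?andbF ?andbT //.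
rewrite E3 -/S2 E4 in E2.
have := IHk G' S2; rewrite cS2 in le_k S6 dense *.
move=> /(_ (ltnW le_k) drawn' pr2 (ltnW (S6 : 3 < #|S2|))).
by clear - E1 E2 dense cod v3; lia.
Qed.

End BipartiteDensity.

(** * Hall and Galvin *)

Section Hall.
Variables (V : finType) (r : rel V).
Implicit Types (X Z : {set V}) (cap : V -> nat).

(** The neighbourhood of Z in Hall's condition. *)
Definition touched X Z : {set V} := [set x in X | [exists y in Z, r x y]].

Lemma touchedP X Z x : reflect (x \in X /\ exists2 y, y \in Z & r x y) (x \in touched X Z).
Proof. by rewrite inE; apply: (iffP andP) => -[xX /exists_inP]. Qed.

Lemma touchedU X Z1 Z2 : touched X (Z1 :|: Z2) = touched X Z1 :|: touched X Z2.
Proof.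
apply/setP => x; apply/touchedP/setUP => [[xX [y]]|[]/touchedP[xX [y yZ xy]]].
- by rewrite inE => /orP[] yZ xy; [left|right]; apply/touchedP; split=> //; exists y.
- by split=> //; exists y; rewrite // inE yZ.
- by split=> //; exists y; rewrite // inE yZ orbT.
Qed.

Lemma touchedI X Z1 Z2 : touched X (Z1 :&: Z2) \subset touched X Z1 :&: touched X Z2.
Proof.
apply/subsetP => x /touchedP[xX [y]]; rewrite inE => /andP[y1 y2] xy.
by rewrite inE; apply/andP; split; apply/touchedP; split=> //; exists y.
Qed.

(** Modularity of demands; with submodularity of neighbourhoods it makes the
    sets that are tight for Hall's condition closed under union. *)
Lemma sum_setUI (F : V -> nat) Z1 Z2 :
  \sum_(y in Z1 :|: Z2) F y + \sum_(y in Z1 :&: Z2) F y = \sum_(y in Z1) F y + \sum_(y in Z2) F y.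
Proof.
rewrite !(big_mkcond (fun y => y \in _)) -!big_split /=; apply: eq_bigr => y _.
by rewrite !inE; case: (y \in Z1); case: (y \in Z2); rewrite /= ?addn0.
Qed.

(** Hall's theorem with demands: f sends each x to the only y that it may serve.
    One unit of demand at y0 is served at a time, by an x outside the
    neighbourhood of the largest tight set avoiding y0; this keeps Hall's
    condition for what remains. *)
Lemma demand_matching X cap :
  (forall Z, \sum_(y in Z) cap y <= #|touched X Z|) ->
  exists f : V -> V, forall y, cap y <= #|[set x in X | r x y && (f x == y)]|.
Proof.
have [k] := ubnP (\sum_(y : V) cap y); elim: k X cap => // k IHk X cap.
rewrite ltnS => le_k hall.
have [/existsP[y0 y0_gt0]|] := boolP [exists y, 0 < cap y]; last first.
  rewrite negb_exists => /forallP cap0; exists id => y.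
  by have := cap0 y; rewrite -eqn0Ngt => /eqP->.
pose tight (Z : {set V}) := (y0 \notin Z) && (#|touched X Z| == \sum_(y in Z) cap y).
have tight0 : tight set0.
  rewrite /tight inE big_set0 cards_eq0 /=; apply/eqP/setP => x; rewrite [RHS]inE.
  by apply/negP => /touchedP[_ [y]]; rewrite inE.
case: (@arg_maxnP _ set0 tight (fun Z => #|Z|) tight0) => T /andP[y0T /eqP tightT] maxT.
have tight_sub Z : tight Z -> Z \subset T.
  case/andP=> y0Z /eqP tightZ.
  (* Neighbourhood sizes are submodular and demands are modular. *)
  have tightU : tight (T :|: Z).
    rewrite /tight inE negb_or y0T y0Z /= eqn_leq hall andbT.
    have := sum_setUI cap T Z; rewrite -tightT -tightZ -cardsUI -touchedU.
    have := subset_leq_card (touchedI X T Z); have := hall (T :&: Z).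
    clear; lia.
  have := maxT _ tightU => le_T.
  have /eqP E : T == T :|: Z by rewrite eqEcard subsetUl.
  by rewrite E subsetUr.
have [x xy0 xT] : exists2 x, x \in touched X [set y0] & x \notin touched X T.
  apply/subsetPn/negP => sub; have := hall (y0 |: T).
  rewrite big_setU1 //= -tightT touchedU (setUidPr sub) -[X in _ <= X -> _]add0n leq_add2r.
  by rewrite leqNgt y0_gt0.
have /touchedP[xX [y1 /set1P -> rxy0]] := xy0.
pose cap' y := if y == y0 then (cap y).-1 else cap y.
have capE Z : \sum_(y in Z) cap y = \sum_(y in Z) cap' y + (y0 \in Z).
  have [y0Z|y0Z] := boolP (y0 \in Z).
    rewrite !(big_setD1 y0 y0Z) /= {1}/cap' eqxx.
    rewrite [X in _ = _ + X + _](eq_bigr cap) => [|y]; last first.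
      by rewrite !inE /cap' => /andP[/negPf->].
    by move: y0_gt0; clear; lia.
  rewrite addn0; apply: eq_bigr => y yZ; rewrite /cap'; case: eqP => // E.
  by rewrite -E yZ in y0Z.
have [||f Hf] := IHk (X :\ x) cap'.
- have sumT (F : V -> nat) : \sum_(y in [set: V]) F y = \sum_y F y.
    by apply: eq_bigl => y; rewrite inE.
  by have := capE [set: V]; rewrite !sumT inE; move: le_k; clear; rewrite /=; lia.
- move=> Z; have tE : touched (X :\ x) Z = touched X Z :\ x.
    apply/setP => x'; by rewrite !inE -andbA.
  rewrite tE; have := hall Z; rewrite capE (cardsD1 x).
  have [y0Z|y0Z] := boolP (y0 \in Z); first by case: (x \in _) => /=; clear; lia.
  have [xZ|xZ] := boolP (x \in touched X Z); last by rewrite /=; clear; lia.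
  have : ~~ tight Z.
    apply: contra xT => /tight_sub ZT; have /touchedP[_ [y yZ xy]] := xZ.
    by apply/touchedP; split=> //; exists y => //; apply: (subsetP ZT).
  rewrite /tight y0Z /= capE (cardsD1 x) xZ (negPf y0Z) /=; clear; lia.
exists (fun x' => if x' == x then y0 else f x') => y.
have subY : [set x' in X :\ x | r x' y && (f x' == y)] \subset
    [set x' in X | r x' y && ((if x' == x then y0 else f x') == y)] :\ x.
  by apply/subsetP => x'; rewrite !inE => /andP[/andP[nx ->] xy]; rewrite (negPf nx) xy.
rewrite (cardsD1 x); have := subset_leq_card subY; have := Hf y; rewrite /cap'.
have [->|ny] := eqVneq y y0; first by rewrite !inE eqxx xX rxy0 eqxx /=; clear; lia.
clear; lia.
Qed.

End Hall.

Section Galvin.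
Variables (T : finType) (V : eqType) (px py : T -> V) (rx ry : T -> nat).
Implicit Types E S : {set T}.

(** Two edges e, f of a bipartite graph are compared where they meet: smaller
    [rx] is preferred at the common end under [px], smaller [ry] at that under
    [py]. *)
Definition better e f : bool :=
  ((px f == px e) && (rx f < rx e)) || ((py f == py e) && (ry f < ry e)).
Definition clash e f : bool := (px e == px f) || (py e == py f).

Hypothesis rx_inj : forall e f, px e = px f -> rx e = rx f -> e = f.
Hypothesis ry_inj : forall e f, py e = py f -> ry e = ry f -> e = f.

(** Gale and Shapley: if the favourite edges of two vertices x meet in the same
    y, the one that y likes less can be dropped, because whatever dominates the
    other one there dominates it too. *)
Lemma stable_matching E : exists S, [/\ S \subset E,
  {in S &, forall e f, e != f -> ~~ clash e f}
  & {in E :\: S, forall e, exists2 f, f \in S & better e f}].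
Proof.
have [k] := ubnP #|E|; elim: k E => // k IHk E; rewrite ltnS => le_k.
pose tops := [set e in E | [forall f in E, (px f == px e) ==> (rx e <= rx f)]].
have topP e : e \in tops -> e \in E /\ forall f, f \in E -> px f = px e -> rx e <= rx f.
  rewrite inE => /andP[eE /forall_inP H]; split=> // f fE /eqP.
  by move: (H f fE) => /implyP; apply.
have [/existsP[e1 /existsP[e2 /and5P[t1 t2 ne /eqP py12 ry12]]]|] :=
    boolP [exists e1, exists e2, [&& e1 \in tops, e2 \in tops, e1 != e2, py e1 == py e2 & ry e1 < ry e2]].
- have [e1E min1] := topP _ t1; have [e2E _] := topP _ t2.
  have [|S [SE indS domS]] := IHk (E :\ e2).
    by rewrite (leq_trans _ le_k) // [X in _ < X](cardsD1 e2) e2E.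
  exists S; split=> //; first exact: subset_trans SE (subD1set _ _).
  move=> e; rewrite inE => /andP[eS eE].
  have [e_e2|ne2] := eqVneq e e2; last by apply: domS; rewrite !inE eS ne2.
  have [e1S|e1S] := boolP (e1 \in S).
    by exists e1 => //; rewrite /better e_e2 py12 eqxx ry12 orbT.
  have [|f fS] := domS e1; first by rewrite !inE e1S ne.
  have fE : f \in E by have /subsetP/(_ f fS) := SE; rewrite !inE => /andP[].
  rewrite /better => /orP[/andP[/eqP pf]|/andP[/eqP pf rf]].
    by rewrite ltnNge min1.
  by exists f; rewrite // /better e_e2 pf py12 eqxx (ltn_trans rf) ?orbT.
- rewrite negb_exists => /forallP no; exists tops; split.
  + by apply/subsetP => e /topP[].
  + move=> e f te tf ne; apply/negP => /orP[/eqP pe|/eqP pe].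
      have [eE mine] := topP _ te; have [fE minf] := topP _ tf.
      by move: ne; rewrite (rx_inj pe) ?eqxx //; apply/eqP; rewrite eqn_leq mine // minf.
    have := no e; rewrite negb_exists => /forallP/(_ f).
    have := no f; rewrite negb_exists => /forallP/(_ e).
    rewrite te tf ne eq_sym ne pe eqxx /= -!leqNgt => le1 le2.
    by move: ne; rewrite (ry_inj pe) ?eqxx //; apply/eqP; rewrite eqn_leq le1 le2.
  + move=> e; rewrite inE => /andP[eT eE].
    have Pe : (e \in E) && (px e == px e) by rewrite eE eqxx.
    case: (@arg_minnP _ e (fun f => (f \in E) && (px f == px e)) rx Pe) => f /andP[fE pf] minf.
    have tf : f \in tops.
      rewrite inE fE; apply/forall_inP => f' f'E; apply/implyP => pf'.
      by apply: minf; rewrite f'E (eqP pf') pf.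
    exists f => //; rewrite /better pf /=; apply/orP; left.
    rewrite ltn_neqAle minf ?Pe // andbT; apply: contra eT => /eqP E'.
    by rewrite -(rx_inj (eqP pf) E').
Qed.
End Galvin.

Section GalvinList.
Variables (T C : finType) (V : eqType) (px py : T -> V) (rx ry : T -> nat) (c0 : C).
Hypothesis rx_inj : forall e f, px e = px f -> rx e = rx f -> e = f.
Hypothesis ry_inj : forall e f, py e = py f -> ry e = ry f -> e = f.

(** Galvin's argument: a colour c is given to a stable matching among the edges
    that admit it; every other such edge loses c from its list, but also one of
    the edges it had to yield to. *)
Lemma galvin_list_colouring (E : {set T}) (L : T -> {set C}) :
  {in E, forall e, #|[set f in E | (px f == px e) && (rx f < rx e)]|
                   + #|[set f in E | (py f == py e) && (ry f < ry e)]| < #|L e|} ->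
  exists s : T -> C, {in E, forall e, s e \in L e} /\
    {in E &, forall e f, e != f -> clash px py e f -> s e != s f}.
Proof.
have [k] := ubnP #|E|; elim: k E L => // k IHk E L; rewrite ltnS => le_k large.
have [->|[e0 e0E]] := set_0Vmem E.
  by exists (fun=> c0); split=> [e|e f]; rewrite inE.
have /card_gt0P[c cL] : 0 < #|L e0| by apply: leq_ltn_trans (large e0 e0E).
pose Ec := [set e in E | c \in L e].
have [S [SEc indS domS]] := @stable_matching T V px py rx ry rx_inj ry_inj Ec.
have SE : S \subset E by apply: subset_trans SEc _; apply/subsetP => e; rewrite inE => /andP[].
have [g gS] : exists g, g \in S.
  have [e0S|e0S] := boolP (e0 \in S); first by exists e0.
  by have [|g gS _] := domS e0; [rewrite !inE e0S e0E cL | exists g].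
have [||s [sL s_ok]] := IHk (E :\: S) (fun e => L e :\ c).
- rewrite (leq_trans _ le_k) // proper_card // properEneq subsetDl andbT.
  by apply/negP => /eqP/setP/(_ g); rewrite inE gS (subsetP SE g gS).
- move=> e; rewrite inE => /andP[eS eE].
  have subx : [set f in E :\: S | (px f == px e) && (rx f < rx e)]
      \subset [set f in E | (px f == px e) && (rx f < rx e)] :\: S.
    by apply/subsetP => f; rewrite !inE => /andP[/andP[-> ->] ->].
  have suby : [set f in E :\: S | (py f == py e) && (ry f < ry e)]
      \subset [set f in E | (py f == py e) && (ry f < ry e)] :\: S.
    by apply/subsetP => f; rewrite !inE => /andP[/andP[-> ->] ->].
  have := subset_leq_card subx; have := subset_leq_card suby.
  have := large e eE; rewrite (cardsD1 c).
  rewrite -(cardsID S [set f in E | (px f == px e) && (rx f < rx e)]).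
  rewrite -(cardsID S [set f in E | (py f == py e) && (ry f < ry e)]).
  have [cLe|cLe] := boolP (c \in L e); last by rewrite /=; clear; lia.
  have [|f fS] := domS e; first by rewrite !inE eS eE cLe.
  have fE := subsetP SE f fS.
  rewrite /better => /orP[] Hf.
    have : 0 < #|[set f in E | (px f == px e) && (rx f < rx e)] :&: S|.
      by apply/card_gt0P; exists f; rewrite !inE fE fS Hf.
    by clear; rewrite /=; lia.
  have : 0 < #|[set f in E | (py f == py e) && (ry f < ry e)] :&: S|.
    by apply/card_gt0P; exists f; rewrite !inE fE fS Hf.
  by clear; rewrite /=; lia.
have sLE e : e \in E -> e \notin S -> (s e \in L e) /\ (s e != c).
  by move=> eE eS; have := sL e; rewrite !inE eS eE => /(_ isT)/andP[].
exists (fun e => if e \in S then c else s e); split=> [e eE|e f eE fE ne clash_ef].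
  case: ifP => [eS|/negbT eS]; last by case: (sLE e eE eS).
  by have := subsetP SEc e eS; rewrite inE => /andP[].
case: ifP => [eS|/negbT eS]; case: ifP => [fS|/negbT fS].
- by have := indS e f eS fS ne; rewrite clash_ef.
- by rewrite eq_sym; case: (sLE f fE fS).
- by case: (sLE e eE eS).
- by apply: s_ok; rewrite ?inE ?eS ?fS.
Qed.

End GalvinList.

(** * Reducible configurations *)

Definition far (a b : nat) : bool := (a.+1 < b) || (b.+1 < a).

Lemma far_sym a b : far a b = far b a.
Proof. by rewrite /far orbC. Qed.

Section Labellings.
Variables (V : finType) (K : nat).
Notation C := 'I_K.
Implicit Types (adj : rel V).

Definition labelling adj (vc : V -> C) (ec : V -> V -> C) : Prop :=
  [/\ forall u v, adj u v -> vc u != vc v,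
      forall u v, adj u v -> ec u v = ec v u,
      forall u v w, adj u v -> adj u w -> v != w -> ec u v != ec u w
    & forall u v, adj u v -> far (vc u) (ec u v)].

Definition labellable adj : Prop := exists vc ec, labelling adj vc ec.

Definition close_to (c : C) : {set C} := [set x : C | ~~ far c x].

Lemma card_close_to c : #|close_to c| <= 3.
Proof.
rewrite cardE -(size_map val); apply: (@uniq_leq_size _ _ [:: c.-1; val c; c.+1]).
  by rewrite map_inj_uniq ?enum_uniq //; apply: val_inj.
move=> _ /mapP[x + ->]; rewrite mem_enum inE /far negb_or -!leqNgt !inE /=.
by move: (val c) (val x) => a b; clear; lia.
Qed.

Lemma card_close_to_bigcup (I : finType) (A : {set I}) (h : I -> C) :
  #|\bigcup_(i in A) close_to (h i)| <= 3 * #|A|.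
Proof.
rewrite mulnC -sum_nat_const.
apply: leq_trans (_ : \sum_(i in A) #|close_to (h i)| <= _).
  elim/big_rec2: _ => [|i m s _ le_s]; first by rewrite cards0.
  by rewrite (leq_trans (leq_card_setU _ _)) // leq_add2l.
by apply: leq_sum => i _; apply: card_close_to.
Qed.

(** The vertices of the independent set X receive the labels [vn], and the edges
    xy with x in X and [D x y] the labels [en x y]; everything else keeps its
    label from the graph without these edges. *)
Lemma labelling_extend adj (X : {set V}) (D : rel V) vc ec (vn : V -> C) (en : V -> V -> C) :
  symmetric adj -> irreflexive adj ->
  (forall x x', x \in X -> x' \in X -> ~~ adj x x') ->
  labelling (fun u v => [&& adj u v, ~~ ((u \in X) && D u v) & ~~ ((v \in X) && D v u)]) vc ec ->
  (forall x y, x \in X -> adj x y -> vn x != vc y) ->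
  (forall x y, x \in X -> adj x y -> ~~ D x y -> far (vn x) (ec x y)) ->
  (forall x y, x \in X -> adj x y -> D x y -> far (vn x) (en x y) && far (vc y) (en x y)) ->
  (forall x y z, x \in X -> adj x y -> D x y -> adj y z -> z != x ->
     en x y != if (z \in X) && D z y then en z y else ec y z) ->
  (forall x y z, x \in X -> adj x y -> D x y -> adj x z -> z != y ->
     en x y != if D x z then en x z else ec x z) ->
  labellable adj.
Proof.
move=> sym irr indX [okv oks oke okf] Hv Hfar Hnew Hy Hx.
pose vc' u := if u \in X then vn u else vc u.
pose ec' u v := if (u \in X) && D u v then en u v
                else if (v \in X) && D v u then en v u else ec u v.
have old u v : adj u v -> ~~ ((u \in X) && D u v) -> ~~ ((v \in X) && D v u) ->
    [&& adj u v, ~~ ((u \in X) && D u v) & ~~ ((v \in X) && D v u)].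
  by move=> -> -> ->.
have indXF u v : adj u v -> u \in X -> v \in X = false.
  by move=> uv uX; apply: contraTF uv => vX; apply: indX.
exists vc', ec'; split.
- move=> u v uv; rewrite /vc'; case: ifP => uX.
    by rewrite (indXF _ _ uv uX); apply: Hv.
  case: ifP => vX; first by rewrite eq_sym; apply: Hv => //; rewrite sym.
  by apply: okv; apply: old; rewrite ?uX ?vX.
- move=> u v uv; rewrite /ec'; case: ifP => [/andP[uX uD]|uN].
    by rewrite (indXF _ _ uv uX).
  case: ifP => // vN; apply: oks; exact: old (negbT uN) (negbT vN).
- move=> u v w uv uw vw; rewrite /ec'.
  have [uX|uX] := boolP (u \in X).
    rewrite (indXF _ _ uv uX) (indXF _ _ uw uX) /=.
    case: ifP => uDv; first by apply: Hx; rewrite // eq_sym.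
    case: ifP => uDw.
      by have := Hx u w v uX uw uDw uv vw; rewrite uDv eq_sym.
    apply: oke => //; rewrite uX ?uDv ?uDw /= ?(indXF _ _ uv uX) ?(indXF _ _ uw uX) ?andbT //.
  rewrite /=; case: ifP => [/andP[vX vDu]|vN].
    apply: Hy => //; rewrite 1?sym 1?eq_sym //.
  case: ifP => [/andP[wX wDu]|wN].
    rewrite sym in uw; have := Hy w u v wX uw wDu uv vw.
    by rewrite vN eq_sym.
  by apply: oke; rewrite // (negPf uX) ?vN ?wN andbT.
- move=> u v uv; rewrite /vc' /ec'; case: ifP => uX /=.
    rewrite (indXF _ _ uv uX) /=; case: ifP => uD; last by apply: Hfar; rewrite ?uD.
    by case/andP: (Hnew u v uX uv uD).
  case: ifP => [/andP[vX vD]|vN].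
    by rewrite sym in uv; case/andP: (Hnew v u vX uv vD).
  by apply: okf; rewrite uX vN uv.
Qed.

End Labellings.

Section Reducible.
Variables (V : finType) (M : nat) (adj : rel V).
Notation K := M.+3.
Notation C := 'I_K.
Notation N u := (nbrs adj [set: V] u).
Notation deg u := #|nbrs adj [set: V] u|.
Hypotheses (sym : symmetric adj) (irr : irreflexive adj).
Hypothesis M12 : 12 <= M.
Hypothesis deg_le : forall u, deg u <= M.
Hypothesis minimal : forall adj', symmetric adj' -> subrel adj' adj ->
  (exists u v, adj u v && ~~ adj' u v) -> labellable K adj'.
Hypothesis bad : ~ labellable K adj.

Lemma in_N u v : (v \in N u) = adj u v.
Proof. by rewrite in_nbrs inE. Qed.

(** Delete the edges from u to W and forget the label of u.  Then B holds the
    labels of u compatible with all labels kept, and L w those of the edge uw;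
    minimality leaves no compatible choice from these lists. *)
Lemma star_recolouring u (W : {set V}) : W \subset N u -> W != set0 ->
  exists (B : {set C}) (L : V -> {set C}),
  [/\ K <= #|B| + deg u + 3 * (deg u - #|W|),
      forall w, w \in W -> K < #|L w| + 3 + deg w + (deg u - #|W|)
    & forall (b : C) (s : V -> C), b \in B ->
        (forall w, w \in W -> (s w \in L w) && far b (s w)) ->
        {in W &, injective s} -> False].
Proof.
move=> WN /set0Pn[w0 w0W].
have uW w : w \in W -> adj u w by move/(subsetP WN); rewrite in_N.
pose adj' : rel V := fun x y => [&& adj x y, ~~ ((x \in [set u]) && (y \in W)) & ~~ ((y \in [set u]) && (x \in W))].
have [|||vc [ec lab]] := @minimal adj'.
- by move=> x y; rewrite /adj' sym; congr (_ && _); rewrite andbC.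
- by move=> x y /andP[].
- by exists u, w0; rewrite /adj' uW //= !inE eqxx w0W.
pose F := N u :\: W.
have cF : #|F| = deg u - #|W| by rewrite cardsDS.
exists (~: (vc @: N u :|: \bigcup_(f in F) close_to (ec u f))).
exists (fun w => ~: (close_to (vc w) :|: ec w @: (N w :\ u) :|: ec u @: F)).
split.
- rewrite -cF cardsCs setCK card_ord.
  have arith k x a b d f : x <= a + b -> a <= d -> b <= 3 * f -> k <= k - x + d + 3 * f.
    by clear; lia.
  exact: arith (leq_card_setU _ _).1 (leq_imset_card _ _) (card_close_to_bigcup _ _).
- move=> w wW; rewrite -cF cardsCs setCK card_ord.
  have -> : deg w = #|N w :\ u|.+1 by rewrite (cardsD1 u) in_N sym uW.
  have arith k x y a b c d f : x <= y + c -> y <= a + b -> a <= 3 -> b <= d -> c <= f ->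
      k < k - x + 3 + d.+1 + f.
    by clear; lia.
  exact: arith (leq_card_setU _ _).1 (leq_card_setU _ _).1 (card_close_to _)
               (leq_imset_card _ _) (leq_imset_card _ _).
move=> b s bB sL s_inj; apply: bad.
have bP y : adj u y -> b != vc y.
  move=> uy; apply: contraTneq bB => ->; rewrite !inE negbK.
  by rewrite imset_f ?in_N.
have bF y : adj u y -> y \notin W -> far b (ec u y).
  move=> uy yW; apply: contraTT bB; rewrite far_sym => nb; rewrite !inE negbK.
  by apply/orP; right; apply/bigcupP; exists y; rewrite !inE ?yW ?in_N.
have sP w : w \in W -> [/\ far (vc w) (s w), forall z, adj w z -> z != u -> s w != ec w z,
    forall f, adj u f -> f \notin W -> s w != ec u f & far b (s w)].
  move=> wW; have /andP[+ ->] := sL w wW; rewrite in_setC !in_setU !negb_or.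
  rewrite inE negbK => /andP[/andP[-> n1] n2]; split=> //.
    by move=> z wz zu; apply: contraNneq n1 => ->; rewrite imset_f // !inE zu.
  by move=> f uf fW; apply: contraNneq n2 => ->; rewrite imset_f // !inE fW.
apply: (@labelling_extend _ _ adj [set u] (fun _ w => w \in W) vc ec (fun=> b) (fun _ w => s w)) => //.
- by move=> x x' /set1P-> /set1P->; rewrite irr.
- by move=> x y /set1P->; apply: bP.
- by move=> x y /set1P->; apply: bF.
- by move=> x y /set1P-> _ yW; have [-> _ _ ->] := sP y yW.
- move=> x y z /set1P-> uy yW yz zu; rewrite inE (negPf zu) /=.
  by have [_ + _ _] := sP y yW; apply.
- move=> x y z /set1P-> uy yW uz zy; case: ifP => [zW|/negbT zW].
    by apply: contra zy => /eqP E; apply/eqP; apply: s_inj.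
  by have [_ _ + _] := sP y yW; apply.
Qed.

(** With few neighbours the vertex u can be labelled last, whatever label the
    edge uv has received. *)
Lemma light_vertex u v : deg u <= 3 -> adj u v -> M.+2 <= deg u + deg v.
Proof.
move=> du uv; rewrite leqNgt; apply/negP => lt_uv.
have vN : [set v] \subset N u by rewrite sub1set in_N.
have [||B [L [cB cL ext]]] := @star_recolouring u [set v] => //.
  by apply/set0Pn; exists v; rewrite inE.
have d_gt0 : 0 < deg u by apply/card_gt0P; exists v; rewrite in_N.
have := cL v (set11 v); rewrite cards1 => cLv.
have /card_gt0P[c cLc] : 0 < #|L v| by move: cLv lt_uv d_gt0; clear; lia.
have : ~~ (B \subset close_to c).
  apply/negP => /subset_leq_card; move: cB du (card_close_to c) d_gt0 M12; rewrite cards1; clear; lia.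
move=> /subsetPn[b bB]; rewrite inE negbK => far_cb.
apply: (ext b (fun=> c)) => // [w /set1P->|w w' /set1P-> /set1P->] //.
by rewrite cLc far_sym.
Qed.

Lemma card_close_to2 (b b' : C) : b != b' -> #|close_to b :&: close_to b'| <= 2.
Proof.
move=> nb; wlog lt_bb' : b b' nb / b < b' => [H|].
  have : (b : nat) != b' by [].
  by rewrite neq_ltn => /orP[]; [|rewrite setIC]; apply: H; rewrite // eq_sym.
rewrite cardE -(size_map val); apply: (@uniq_leq_size _ _ [:: b'.-1; val b']).
  by rewrite map_inj_uniq ?enum_uniq //; apply: val_inj.
move=> _ /mapP[x + ->]; rewrite mem_enum !inE /far !negb_or -!leqNgt /=.
by move: lt_bb'; move: (val b) (val b') (val x) => p q r; clear; lia.
Qed.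

(** u has two candidate labels, and together they exclude at most two labels of
    the edge uv. *)
Lemma four_vertex u v : deg u = 4 -> adj u v -> 8 <= deg v.
Proof.
move=> du uv; rewrite leqNgt; apply/negP => dv.
have vN : [set v] \subset N u by rewrite sub1set in_N.
have [||B [L [cB cL ext]]] := @star_recolouring u [set v] => //.
  by apply/set0Pn; exists v; rewrite inE.
have := cL v (set11 v); rewrite du cards1 => cLv.
have cB2 : 2 <= #|B| by move: cB M12; rewrite du cards1; clear; lia.
have /card_gt1P[b [b' [bB b'B nb]]] := cB2.
have : ~~ (L v \subset close_to b :&: close_to b').
  by apply/negP => /subset_leq_card; move: cLv dv M12 (card_close_to2 nb); clear; lia.
move=> /subsetPn[c cLc]; rewrite in_setI negb_and => /orP[]; rewrite inE negbK => far_bc.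
  apply: (ext b (fun=> c)) => // [w /set1P->|w w' /set1P-> /set1P->] //.
  by rewrite cLc.
apply: (ext b' (fun=> c)) => // [w /set1P->|w w' /set1P-> /set1P->] //.
by rewrite cLc.
Qed.

Lemma disjoint_close_to (B : {set C}) : 4 <= #|B| ->
  exists b b', [/\ b \in B, b' \in B & [disjoint close_to b & close_to b']].
Proof.
move=> B4; have /card_gt0P[b0 b0B] : 0 < #|B| by apply: leq_trans B4.
case: (@arg_minnP _ b0 (mem B) val b0B) => b bB minb.
have [b' b'B far_bb'] : exists2 b', b' \in B & b.+2 < b'.
  apply/exists_inP; apply: contraTT B4; rewrite negb_exists_in => /forall_inP Hn.
  rewrite -ltnNge ltnS cardE -(size_map val).
  apply: (@uniq_leq_size _ _ [:: val b; b.+1; b.+2]).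
    by rewrite map_inj_uniq ?enum_uniq //; apply: val_inj.
  move=> _ /mapP[x + ->]; rewrite mem_enum => xB; rewrite !inE.
  by move: (Hn x xB) (minb x xB) => /=; rewrite -leqNgt; move: (val b) (val x) => p q; clear; lia.
exists b, b'; split=> //; rewrite disjoint_subset; apply/subsetP => x.
rewrite !inE /far negb_or -!leqNgt; move: far_bb'.
by move: (val b) (val b') (val x) => p q r; clear; lia.
Qed.

(** u has four candidate labels, so two of them exclude disjoint intervals of
    labels.  If neither can be completed greedily, each leaves at most two labels
    in the list of uy, hence exactly two, and then at most two in that of ux;
    but no label is excluded twice, and the list of ux has five labels. *)
Lemma five_vertex u x y z : deg u = 5 -> uniq [:: x; y; z] ->
  adj u x -> adj u y -> adj u z -> deg x <= 6 -> deg y <= 7 -> deg z <= 7 -> False.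
Proof.
move=> du; rewrite /= !inE negb_or andbT => /andP[/andP[nxy nxz] nyz] ux uy uz dx dy dz.
pose W := [set x; y; z].
have cW : #|W| = 3.
  by rewrite /W setUC cardsU1 !inE cards2 nxy negb_or !(eq_sym z) nxz nyz.
have WE w : (w \in W) = [|| w == x, w == y | w == z] by rewrite !inE orbA.
have [||B [L [cB cL ext]]] := @star_recolouring u W.
- by apply/subsetP => w; rewrite WE in_N => /or3P[] /eqP->.
- by apply/set0Pn; exists x; rewrite WE eqxx.
have cB4 : 4 <= #|B| by move: cB M12; rewrite du cW; clear; lia.
have cLx : 5 <= #|L x|.
  by have := cL x; rewrite WE eqxx du cW => /(_ isT); move: M12 dx; clear; lia.
have cLy : 4 <= #|L y|.
  by have := cL y; rewrite WE eqxx orbT du cW => /(_ isT); move: M12 dy; clear; lia.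
have cLz : 4 <= #|L z|.
  by have := cL z; rewrite WE eqxx !orbT du cW => /(_ isT); move: M12 dz; clear; lia.
have choose b (w1 w2 w3 : V) : b \in B -> perm_eq [:: w1; w2; w3] [:: x; y; z] ->
    0 < #|L w1 :\: close_to b| -> 1 < #|L w2 :\: close_to b| -> 2 < #|L w3 :\: close_to b| -> False.
  move=> bB pw /card_gt0P[c1 Lc1] L2 L3.
  have /card_gt0P[c2] : 0 < #|(L w2 :\: close_to b) :\ c1|.
    by move: L2; rewrite (cardsD1 c1); case: (_ \in _); clear; lia.
  rewrite in_setD1 => /andP[n21 Lc2].
  have /card_gt0P[c3] : 0 < #|(L w3 :\: close_to b) :\ c1 :\ c2|.
    move: L3; rewrite (cardsD1 c1) (cardsD1 c2).
    by do 2!case: (_ \in _); clear; lia.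
  rewrite !in_setD1 => /and3P[n32 n31 Lc3].
  have : uniq [:: w1; w2; w3].
    by rewrite (perm_uniq pw) /= !inE negb_or nxy nxz nyz.
  rewrite /= !inE negb_or andbT => /andP[/andP[n12 n13] n23].
  have memW w : (w \in W) = [|| w == w1, w == w2 | w == w3].
    by have := perm_mem pw w; rewrite WE !inE => ->.
  apply: (ext b (fun w => if w == w1 then c1 else if w == w2 then c2 else c3) bB).
    move=> w; rewrite memW; case: eqP => [-> _|_]; last case: eqP => [-> _|_]; last case: eqP => [-> _|] //=.
    - by move: Lc1; rewrite !inE negbK andbC.
    - by move: Lc2; rewrite !inE negbK andbC.
    - by move: Lc3; rewrite !inE negbK andbC.
  move=> w w'; rewrite !memW => /or3P[] /eqP-> /or3P[] /eqP->; rewrite ?eqxx //;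
    rewrite ?(eq_sym w2 w1) ?(eq_sym w3 w1) ?(eq_sym w3 w2) ?(negPf n12) ?(negPf n13) ?(negPf n23) ?eqxx => E;
    by move: n21 n31 n32; rewrite ?E ?eqxx // -?E ?eqxx.
have fail b : b \in B -> #|L y :\: close_to b| <= 2 /\ (2 <= #|L y :\: close_to b| -> #|L x :\: close_to b| <= 2).
  move=> bB.
  have pos w : #|L w| <= #|L w :\: close_to b| + 3.
    have := cardsID (close_to b) (L w); have := subset_leq_card (subsetIr (L w) (close_to b)).
    by have := card_close_to b; clear; lia.
  have px := pos x; have py := pos y; have pz := pos z.
  have P1 : perm_eq [:: z; x; y] [:: x; y; z] by exact/permPl/(perm_catC [:: z] [:: x; y]).
  have P2 : perm_eq [:: z; y; x] [:: x; y; z].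
    by rewrite (perm_trans _ P1) // perm_cons; exact/permPl/(perm_catC [:: y] [:: x]).
  split.
    rewrite leqNgt; apply/negP => ly; apply: (choose b z x y bB P1) => //.
      by move: pz cLz; clear; lia.
    by move: px cLx; clear; lia.
  move=> ly; rewrite leqNgt; apply/negP => lx; apply: (choose b z y x bB P2) => //.
  by move: pz cLz; clear; lia.
have [b [b' [bB b'B dis]]] := disjoint_close_to cB4.
have split_card (A : {set C}) : #|A| <= #|A :\: close_to b| + #|A :\: close_to b'|.
  apply: leq_trans (leq_card_setU _ _); apply/subset_leq_card/subsetP => c cA.
  rewrite in_setU !in_setD cA !andbT -negb_and; apply/negP => /andP[cb cb'].
  by rewrite (disjointFr dis cb) in cb'.
have := split_card (L x); have := split_card (L y).
have := fail b bB; have := fail b' b'B; move: cLx cLy; clear; lia.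
Qed.

(** If the bound fails, take a smallest set X of vertices of degree at most 3
    exceeding the capacity, the sum of deg y + 2 - M, of its neighbourhood.  By
    minimality Hall's condition holds, so each neighbour y is served by
    deg y + 2 - M vertices of X, each of which serves only y.  Let each x rank the
    neighbour it serves first, and each y rank the vertices serving it last.
    Then the edges between X and its neighbourhood have lists long enough for
    Galvin's theorem, and the vertices of X can be labelled last. *)
Lemma alternator_bound :
  #|[set x | 0 < deg x <= 3]| <= \sum_(y : V) (deg y + 2 - M).
Proof.
set L3 := [set x | _]; pose cap y := deg y + 2 - M.
rewrite leqNgt; apply/negP => viol.
pose NX (X : {set V}) := [set y | [exists x in X, adj x y]].
have NXP (X : {set V}) y : reflect (exists2 x, x \in X & adj x y) (y \in NX X).
  by rewrite inE; apply: exists_inP.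
pose P (X : {set V}) := (X \subset L3) && (\sum_(y in NX X) cap y < #|X|).
have PL3 : P L3.
  rewrite /P subxx (leq_ltn_trans _ viol) // big_mkcond /=.
  by apply: leq_sum => y _; case: ifP.
case: (@arg_minnP _ L3 P (fun X => #|X|) PL3) => X /andP[/subsetP XL3 violX] minX.
have X3 x : x \in X -> 0 < deg x <= 3 by move/XL3; rewrite inE.
have indX x x' : x \in X -> x' \in X -> ~~ adj x x'.
  move=> /X3/andP[_ dx] /X3/andP[_ dx']; apply/negP => xx'.
  by have := light_vertex dx xx'; move: dx dx' M12; clear; lia.
have [|f Hf] := @demand_matching V adj X (fun y => if y \in NX X then cap y else 0).
  move=> Z; have [Z0|/set0Pn[x0 x0Z]] := eqVneq (touched adj X Z) set0.
    rewrite Z0 cards0 big1 // => y yZ; case: ifP => // /NXP[x xX xy].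
    have : x \in touched adj X Z by apply/touchedP; split=> //; exists y.
    by rewrite Z0 inE.
  have tX : touched adj X Z \subset X by apply/subsetP => x /touchedP[].
  have x0X := subsetP tX x0 x0Z.
  have : ~~ P (X :\: touched adj X Z).
    apply: contraL (x0Z) => PXZ; have := minX _ PXZ; rewrite cardsDS // => le.
    have : #|touched adj X Z| = 0.
      have X_gt0 : 0 < #|X| by apply/card_gt0P; exists x0.
      by move: (subset_leq_card tX) X_gt0 le; clear; lia.
    by move=> /eqP; rewrite cards_eq0 => /eqP->; rewrite inE.
  have subL3 : X :\: touched adj X Z \subset L3.
    by apply/subsetP => x; rewrite inE => /andP[_ /XL3].
  rewrite /P subL3 -leqNgt cardsDS //= => le1.
  have le2 : \sum_(y in NX (X :\: touched adj X Z)) cap y +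
      \sum_(y in Z) (if y \in NX X then cap y else 0) <= \sum_(y in NX X) cap y.
    rewrite !(big_mkcond (fun y => y \in _)) -big_split /=; apply: leq_sum => y _.
    case: ifP => [/NXP[x + xy]|_]; last by case: ifP.
    rewrite inE => /andP[xZ xX]; have -> : y \in NX X by apply/NXP; exists x.
    case: ifP => yZ; last by rewrite addn0.
    by case/touchedP: xZ; split=> //; exists y.
  have := subset_leq_card tX; move: le1 le2 violX; clear; lia.
pose D : rel V := fun _ _ => true.
pose adj' : rel V := fun u v => [&& adj u v, ~~ ((u \in X) && D u v) & ~~ ((v \in X) && D v u)].
have [|||vc [ec lab]] := @minimal adj'.
- by move=> u v; rewrite /adj' sym; congr (_ && _); rewrite andbC.
- by move=> u v /andP[].
- have /card_gt0P[x xX] : 0 < #|X| by apply: leq_ltn_trans violX.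
  have /andP[/card_gt0P[y]] := X3 x xX; rewrite in_N => xy _.
  by exists x, y; rewrite /adj' xy xX.
pose E := [set e : V * V | (e.1 \in X) && adj e.1 e.2].
pose L (e : V * V) : {set C} := ~: (close_to (vc e.2) :|: ec e.2 @: (N e.2 :\: X)).
(* At x the neighbour it serves comes first; at y the vertices serving it come
   last, being shifted by the number of all vertices. *)
pose rx (e : V * V) : nat := if f e.1 == e.2 then 0 else (enum_rank e.2).+1.
pose ry (e : V * V) : nat := enum_rank e.1 + (if f e.1 == e.2 then #|V| else 0).
have rx_inj e g : e.1 = g.1 -> rx e = rx g -> e = g.
  case: e g => [x y] [x' y'] /= <-; rewrite /rx /=.
  have [<-|_] := eqVneq (f x) y; have [<-|_] := eqVneq (f x) y' => // -[/val_inj/enum_rank_inj->] //.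
have ry_inj e g : e.2 = g.2 -> ry e = ry g -> e = g.
  case: e g => [x y] [x' y'] /= <-; rewrite /ry /= => Er.
  suff : (enum_rank x : nat) = enum_rank x' by move/val_inj/enum_rank_inj->.
  have arith n p q (b b' : bool) : p < n -> q < n ->
      p + (if b then n else 0) = q + (if b' then n else 0) -> p = q.
    by clear; case: b; case: b'; lia.
  exact: arith (ltn_ord (enum_rank x)) (ltn_ord (enum_rank x')) Er.
have [|s [sL s_ok]] := @galvin_list_colouring _ C V fst snd rx ry (ord0 : C) rx_inj ry_inj E L.
  move=> [x y]; rewrite inE /= => /andP[xX xy].
  have /andP[dx0 dx3] := X3 x xX.
  pose A := N y :&: X; pose Pr := [set x' in X | adj x' y && (f x' == y)].
  have AP x' : (x' \in A) = (x' \in X) && adj x' y by rewrite inE in_N sym andbC.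
  have PrA : Pr \subset A by apply/subsetP => x'; rewrite inE AP => /and3P[-> ->].
  have capPr : deg y + 2 - M <= #|Pr|.
    by have := Hf y; have -> : y \in NX X by apply/NXP; exists x.
  have cL : K <= #|L (x, y)| + 3 + #|N y :\: X|.
    rewrite /L cardsCs setCK card_ord /=.
    have arith k u a b c : u <= a + b -> a <= 3 -> b <= c -> k <= k - u + 3 + c.
      by clear; lia.
    exact: arith (leq_card_setU _ _).1 (card_close_to _) (leq_imset_card _ _).
  have cN : deg y = #|A| + #|N y :\: X| by rewrite cardsID.
  have xA : x \in A by rewrite AP xX.
  set cx := #|_|; set cy := #|_|.
  have bound_x (S : {set V}) : (forall y', adj x y' -> rx (x, y') < rx (x, y) -> y' \in S) -> cx <= #|S|.
    move=> HS; apply: leq_trans (leq_imset_card (pair x) S).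
    apply/subset_leq_card/subsetP => -[x' y']; rewrite !inE /= => /andP[/andP[_ x'y'] /andP[/eqP Ex lt]].
    by rewrite Ex in x'y' lt *; apply: imset_f; apply: HS.
  have bound_y (S : {set V}) : (forall x', x' \in A -> ry (x', y) < ry (x, y) -> x' \in S) -> cy <= #|S|.
    move=> HS; apply: leq_trans (leq_imset_card (fun x' => (x', y)) S).
    apply/subset_leq_card/subsetP => -[x' y']; rewrite !inE /= => /andP[/andP[x'X x'y'] /andP[/eqP Ey lt]].
    by rewrite Ey in x'y' lt *; apply: imset_f; apply: HS; rewrite // AP x'X.
  have [fx|fx] := eqVneq (f x) y.
    have : cx <= #|set0 : {set V}|.
      by apply: bound_x => y' _; rewrite /rx /= fx eqxx.
    have : cy <= #|A :\ x|.
      apply: bound_y => x' x'A; rewrite in_setD1 x'A andbT.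
      by apply: contraTneq => ->; rewrite ltnn.
    have := cardsD1 x A; rewrite xA cards0; have := deg_le y.
    have arith l n d a a1 p q : K <= l + 3 + n -> d = a + n -> d <= M -> a = 1 + a1 ->
        q <= a1 -> p <= 0 -> p + q < l by clear; lia.
    by move=> dy a1 q1 p0; apply: arith cL cN dy a1 q1 p0.
  have : cx <= #|N x :\ y|.
    apply: bound_x => y' xy'; rewrite in_setD1 in_N xy' andbT.
    by apply: contraTneq => ->; rewrite ltnn.
  have : cy <= #|(A :\: Pr) :\ x|.
    apply: bound_y => x' x'A; rewrite in_setD1 in_setD x'A andbT => lt.
    apply/andP; split; first by apply: contraTneq lt => ->; rewrite ltnn.
    apply: contraTN lt; rewrite inE => /and3P[_ _ /eqP fx'].
    rewrite /ry /= fx' eqxx (negPf fx) addn0 -leqNgt.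
    by rewrite (leq_trans (ltnW (ltn_ord _))) // leq_addl.
  have := cardsD1 x (A :\: Pr); have := cardsD1 y (N x).
  have -> : x \in A :\: Pr by rewrite in_setD xA andbT inE (negPf fx) !andbF.
  rewrite in_N xy (cardsDS PrA); have := subset_leq_card PrA; have := deg_le y.
  have arith l n d d1 dx a r a1 p q : K <= l + 3 + n -> d = a + n -> d + 2 - M <= r -> dx <= 3 ->
      d <= M -> r <= a -> dx = 1 + d1 -> a - r = 1 + a1 -> q <= a1 -> p <= d1 -> p + q < l.
    by clear; lia.
  by move=> dy ra dx1 a1 q1 p1; apply: arith cL cN capPr dx3 dy ra dx1 a1 q1 p1.
(* At most 3 neighbours and 9 labels close to incident edges are excluded. *)
pose bads x := vc @: N x :|: \bigcup_(y in N x) close_to (s (x, y)).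
pose vn x : C := odflt ord0 [pick b in ~: bads x].
have vnP x : x \in X -> vn x \notin bads x.
  move=> xX; rewrite /vn; case: pickP => [b|none]; first by rewrite inE.
  have /andP[_ dx] := X3 x xX.
  have : #|~: bads x| = 0 by apply: eq_card0 => b; rewrite none.
  rewrite cardsCs setCK card_ord.
  have arith u a b d : u <= a + b -> a <= d -> b <= 3 * d -> d <= 3 -> K - u <> 0.
    by move: M12; clear; lia.
  by move/(arith _ _ _ _ (leq_card_setU _ _).1 (leq_imset_card _ _) (card_close_to_bigcup _ _) dx).
have inE' x y : x \in X -> adj x y -> (x, y) \in E by move=> xX xy; rewrite inE xX.
have sP x y : x \in X -> adj x y -> far (vc y) (s (x, y)) /\
    forall z, adj y z -> z \notin X -> s (x, y) != ec y z.
  move=> xX xy; have := sL _ (inE' _ _ xX xy); rewrite in_setC in_setU negb_or inE negbK /=.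
  case/andP=> -> n1; split=> // z yz zX.
  by apply: contraNneq n1 => ->; rewrite imset_f // in_setD zX in_N.
apply: bad; apply: (@labelling_extend _ _ adj X D vc ec vn (fun x y => s (x, y))) => //.
- move=> x y xX xy; apply: contraNneq (vnP x xX) => ->.
  by rewrite in_setU imset_f // in_N.
- move=> x y xX xy _; have [-> _] := sP x y xX xy; rewrite andbT far_sym.
  apply: contraNT (vnP x xX) => nf; rewrite in_setU; apply/orP; right.
  by apply/bigcupP; exists y; rewrite ?in_N // inE.
- move=> x y z xX xy _ yz zx; rewrite andbT; case: ifP => [zX|/negbT zX].
    apply: s_ok; rewrite ?inE' // 1?sym //; last by rewrite /clash /= eqxx orbT.
    by rewrite xpair_eqE eqxx andbT eq_sym.
  by have [_] := sP x y xX xy; apply.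
- move=> x y z xX xy _ xz zy /=; apply: s_ok; rewrite ?inE' //.
    by rewrite xpair_eqE eqxx eq_sym.
  by rewrite /clash /= eqxx.
Qed.

End Reducible.

(** * Counting edges of a minimal counterexample *)

Section Counting.
Variable V : finType.
Implicit Types (adj : rel V).

Lemma sum_nbrsC adj (A B : {set V}) : symmetric adj ->
  \sum_(u in A) #|nbrs adj B u| = \sum_(v in B) #|nbrs adj A v|.
Proof.
move=> sym; under eq_bigr => u _ do rewrite -sum_adj.
rewrite exchange_big /=; apply: eq_bigr => v _; rewrite -sum_adj.
by apply: eq_bigr => u _; rewrite sym.
Qed.

Lemma evenly_drawable_arcs_lt adj (S : {set V}) :
  evenly_drawable adj -> S != set0 -> arcs adj S < 6 * #|S|.
Proof.
move=> drawn; rewrite -card_gt0 => S_gt0; have [_ irr _] := drawn.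
have [S3|S2] := ltnP 2 #|S|.
  by have := evenly_drawable_arcs drawn S3; clear; lia.
apply: leq_ltn_trans (_ : \sum_(v in S) 1 < _); last by rewrite sum1_card; move: S_gt0; clear; lia.
apply: leq_sum => v vS; rewrite -ltnS; apply: leq_trans S2.
exact: card_nbrs_lt.
Qed.

Lemma evenly_drawable_bipartite adj (X Y : {set V}) :
  evenly_drawable adj -> [disjoint X & Y] ->
  \sum_(x in X) #|nbrs adj Y x| <= 2 * (#|X| + #|Y|).
Proof.
move=> drawn XY; have [sym irr _] := drawn.
have cXY : #|X :|: Y| = #|X| + #|Y| by rewrite cardsU disjoint_setI0 // cards0 subn0.
have [S3|S2] := ltnP 2 #|X :|: Y|; last first.
  apply: leq_trans (_ : \sum_(x in X) #|Y| <= _).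
    by apply: leq_sum => x _; apply/subset_leq_card/subsetP => y; rewrite in_nbrs => /andP[].
  rewrite sum_nat_const; move: S2; rewrite cXY.
  by case: #|X| => [|[|[|?]]]; case: #|Y| => [|[|[|?]]]; rewrite ?muln0 //; clear; lia.
pose adj' : rel V := fun u v => adj u v && ((u \in X) && (v \in Y) || (u \in Y) && (v \in X)).
have drawn' : evenly_drawable adj'.
  apply: evenly_drawable_sub (drawn) => [u v|u v /andP[] //].
  by rewrite /adj' sym orbC; do 4!case: (_ \in _).
have YX v : v \in Y -> v \in X = false by move=> vY; rewrite (disjointFl XY).
have pr : proper_on adj' (X :|: Y) (mem X).
  move=> u v _ _ /andP[_ /orP[] /andP[]] /=; first by move=> -> /YX ->.
  by move=> /YX -> ->.
have := evenly_drawable_bipartite_arcs drawn' pr S3; rewrite cXY.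
suff -> : arcs adj' (X :|: Y) = 2 * \sum_(x in X) #|nbrs adj Y x| by clear; lia.
rewrite /arcs (eq_bigl [predU X & Y]) => [|v]; last by rewrite !inE.
rewrite bigU //= mul2n -addnn; congr (_ + _); last rewrite (sum_nbrsC X Y sym).
  apply: eq_bigr => x xX; apply: eq_card => y; rewrite !in_nbrs /adj' in_setU xX.
  by rewrite (disjointFr XY xX) /= orbF andbCA; case: (y \in Y); rewrite ?andbF ?orbT ?andbT.
apply: eq_bigr => y yY; apply: eq_card => x; rewrite !in_nbrs /adj' in_setU yY (YX y yY) /=.
by case: (x \in X); rewrite ?andbT // !andbF.
Qed.

(** The reducible configurations and the two density bounds contradict each
    other in a counterexample with fewest edges. *)
Theorem evenly_drawable_labellable (M : nat) adj :
  12 <= M -> evenly_drawable adj -> (forall u, #|nbrs adj [set: V] u| <= M) ->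
  labellable M.+3 adj.
Proof.
move=> M12; have [k] := ubnP (arcs adj [set: V]); elim: k adj => // k IHk adj.
rewrite ltnS => le_k drawn deg_le; have [sym irr _] := drawn.
apply: boolp.contrapT => bad.
have minimal adj' : symmetric adj' -> subrel adj' adj ->
    (exists u v, adj u v && ~~ adj' u v) -> labellable M.+3 adj'.
  move=> sym' sub [u [v /andP[uv nuv]]].
  have sub_N w : nbrs adj' [set: V] w \subset nbrs adj [set: V] w.
    by apply/subsetP => z; rewrite !in_nbrs !inE => /sub.
  apply: IHk; last by move=> w; apply: leq_trans (deg_le w); apply: subset_leq_card.
    apply: leq_trans le_k; rewrite /arcs !(bigD1 u (in_setT u)) /= -addSn leq_add //.
      apply/proper_card/properP; split=> //; exists v; first by rewrite in_nbrs inE.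
      by rewrite in_nbrs inE.
    by apply: leq_sum => w _; apply: subset_leq_card.
  exact: evenly_drawable_sub drawn.
pose N u := nbrs adj [set: V] u; pose deg u := #|N u|.
have inN u v : (v \in N u) = adj u v by rewrite in_nbrs inE.
have light u v : deg u <= 3 -> adj u v -> M.+2 <= deg u + deg v.
  exact: (light_vertex sym irr M12 minimal bad).
have four u v : deg u = 4 -> adj u v -> 8 <= deg v.
  exact: (four_vertex sym irr M12 minimal bad).
have five u x y z : deg u = 5 -> uniq [:: x; y; z] ->
    adj u x -> adj u y -> adj u z -> deg x <= 6 -> deg y <= 7 -> deg z <= 7 -> False.
  exact: (five_vertex sym irr M12 minimal bad).
have := alternator_bound sym irr M12 deg_le minimal bad; rewrite -/deg.
set L3 := [set x | _] => alt.
pose S := [set v | 4 <= deg v]; pose H := [set v | 8 <= deg v].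
pose L4 := [set v | deg v == 4]; pose L5 := [set v | deg v == 5]; pose W := [set v | deg v == 7].
pose G5 := [set v in L5 | 3 <= #|nbrs adj H v|]; pose U := L5 :\: G5.
have deg_gt0 u v : adj u v -> 0 < deg u by move=> uv; apply/card_gt0P; exists v; rewrite inN.
have L3H x y : x \in L3 -> adj x y -> y \in H.
  rewrite !inE => /andP[_ dx] xy; have := light x y dx xy.
  by move: dx M12; clear; rewrite -/(deg x) -/(deg y); lia.
have L4H x y : x \in L4 -> adj x y -> y \in H.
  by rewrite !inE => /eqP dx xy; apply: four dx xy.
have UHW x y : x \in U -> adj x y -> y \in H :|: W.
  rewrite in_setD inE => /andP[+ xL5]; rewrite xL5 /= -ltnNge ltnS => few xy.
  have /eqP dx : deg x == 5 by rewrite inE in xL5.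
  apply: contraT; rewrite in_setU negb_or inE -ltnNge ltnS => /andP[y7]; rewrite inE => yn7.
  have y6 : deg y <= 6 by move: y7 yn7; clear; lia.
  have : 1 < #|N x :\: H :\ y|.
    have := cardsID H (N x); have -> : N x :&: H = nbrs adj H x.
      by apply/setP => z; rewrite in_setI inN in_nbrs andbC.
    have := cardsD1 y (N x :\: H).
    by rewrite in_setD inN xy inE -ltnNge ltnS y7 /= -/(deg x) dx; move: few; clear; lia.
  case/card_gt1P => z [z' []]; rewrite !in_setD1 !in_setD !inN !inE -!ltnNge !ltnS => /and3P[zy z7 xz] /and3P[z'y z'7 xz'] zz'.
  exfalso; apply: (five x y z z') => //.
  by rewrite /= !inE negb_or !(eq_sym y) zy z'y zz'.
pose s3 := \sum_(x in L3) deg x; pose d8 := \sum_(v in H) (deg v - 8).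
have S_neq0 : S != set0.
  apply/negP => /eqP S0; apply: bad; exists (fun=> ord0), (fun _ _ => ord0).
  have no_adj u v : adj u v -> False.
    move=> uv; have : u \notin S by rewrite S0 inE.
    have : v \notin S by rewrite S0 inE.
    rewrite !inE -!ltnNge !ltnS => dv du; have := light u v du uv.
    by move: du dv M12; clear; lia.
  by split=> [u v|u v|u v w|u v] /no_adj.
have in_all x (A : {set V}) : (forall y, adj x y -> y \in A) -> #|nbrs adj A x| = deg x.
  move=> xA; apply: eq_card => y; rewrite inN in_nbrs andb_idl //; exact: xA.
have I1 : \sum_(v in S) deg v < 6 * #|S| + s3.
  have -> : \sum_(v in S) deg v = arcs adj S + \sum_(v in S) #|nbrs adj L3 v|.
    rewrite -big_split /=; apply: eq_bigr => v _; rewrite /deg -(cardsID S (N v)); congr (_ + _).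
      by apply: eq_card => y; rewrite in_setI inN in_nbrs andbC.
    apply: eq_card => y; rewrite in_setD inN in_nbrs andbC !inE -ltnNge ltnS -/(deg y).
    case vy : (adj v y); rewrite ?andbF //; rewrite sym in vy.
    by rewrite (deg_gt0 y v) //= andbT.
  rewrite sum_nbrsC // -addSn leq_add //; first exact: evenly_drawable_arcs_lt.
  by apply: leq_sum => x _; apply/subset_leq_card/subsetP => y; rewrite inN in_nbrs => /andP[].
have cardE (A B : {set V}) : A \subset B -> #|A| = \sum_(v in B) (v \in A).
  move=> /setIidPr AB; rewrite -[in LHS]AB -sum1_card big_mkcond [RHS]big_mkcond /=.
  by apply: eq_bigr => v _; rewrite inE; case: (v \in B); case: (v \in A).
have I2 : 6 * #|S| + #|W| + d8 + 2 * #|H| <= \sum_(v in S) deg v + 2 * #|L4| + #|L5|.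
  have HS : H \subset S by apply/subsetP => v; rewrite !inE; apply: leq_trans.
  have WS : W \subset S by apply/subsetP => v; rewrite !inE => /eqP->.
  have L4S : L4 \subset S by apply/subsetP => v; rewrite !inE => /eqP->.
  have L5S : L5 \subset S by apply/subsetP => v; rewrite !inE => /eqP->.
  have -> : d8 = \sum_(v in S) (if v \in H then deg v - 8 else 0).
    rewrite /d8 -big_mkcondr; apply: eq_bigl => v.
    by rewrite andbC andb_idr // => vH; apply: (subsetP HS).
  rewrite (cardE W S) // (cardE H S) // (cardE L4 S) // (cardE L5 S) //.
  rewrite mulnC -sum_nat_const !big_distrr /= -!big_split /=.
  apply: leq_sum => v; rewrite !inE -/(deg v); move: (deg v) => d; clear.
  by case: d => [|[|[|[|[|[|[|[|d]]]]]]]] //= _; rewrite !muln0 !addn0 muln1; lia.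
have alt8 : 2 * #|L3| <= d8.
  apply: leq_trans (leq_mul (leqnn 2) alt) _.
  rewrite big_distrr /d8 [X in _ <= X]big_mkcond /=; apply: leq_sum => y _.
  have := deg_le y; rewrite -/(deg y) inE; move: M12; move: (deg y) => d; clear.
  by case: ifP; lia.
have disP (A B : {set V}) : (forall v, v \in A -> v \notin B) -> [disjoint A & B].
  by move=> AB; rewrite disjoint_subset; apply/subsetP => v /AB; rewrite !inE.
have leU (A B : {set V}) : #|A :|: B| <= #|A| + #|B| := (leq_card_setU A B).1.
have L4P v : v \in L4 -> deg v = 4 by rewrite inE => /eqP.
have L5P v : v \in L5 -> deg v = 5 by rewrite inE => /eqP.
have G5P v : v \in G5 -> deg v = 5 /\ 3 <= #|nbrs adj H v|.
  by rewrite inE => /andP[/L5P].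
have UP v : v \in U -> deg v = 5 /\ v \notin G5 by rewrite inE => /andP[? /L5P].
have L3P v : v \in L3 -> deg v <= 3 by rewrite inE => /andP[].
have low_H v : deg v <= 5 -> v \notin H :|: W.
  by rewrite !inE -/(deg v) negb_or; move: (deg v) => d; clear; lia.
have low_L34 v : v \in L3 :|: L4 -> deg v <= 4.
  by rewrite inE => /orP[/L3P/leq_trans->|/L4P->].
have dis34 : [disjoint L3 & L4].
  by apply: disP => v /L3P d3; apply/negP => /L4P d4; rewrite d4 in d3.
have dis5 (A : {set V}) : A \subset L5 -> [disjoint L3 :|: L4 & A].
  move=> /subsetP AL5; apply: disP => v /low_L34 d4; apply/negP => /AL5/L5P d5.
  by rewrite d5 in d4.
have GL5 : G5 \subset L5 by apply/subsetP => v; rewrite inE => /andP[].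
have UL5 : U \subset L5 by apply/subsetP => v; rewrite inE => /andP[].
have s34 (Y : {set V}) : H \subset Y ->
    \sum_(x in L3 :|: L4) #|nbrs adj Y x| = s3 + 4 * #|L4|.
  move=> /subsetP HY; rewrite sum_setU // mulnC -sum_nat_const; congr (_ + _).
    by apply: eq_bigr => x xL; apply: in_all => y /(L3H _ _ xL)/HY.
  by apply: eq_bigr => x xL; rewrite -(L4P x xL); apply: in_all => y /(L4H _ _ xL)/HY.
have B1 : s3 + 4 * #|L4| + 3 * #|G5| <= 2 * (#|L3| + #|L4| + #|G5| + #|H|).
  have disH : [disjoint (L3 :|: L4) :|: G5 & H].
    apply: disP => v vX; have : v \notin H :|: W; last by rewrite in_setU negb_or => /andP[].
    by apply: low_H; move: vX; rewrite in_setU => /orP[/low_L34/leq_trans->|/G5P[->]].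
  have := evenly_drawable_bipartite drawn disH.
  rewrite sum_setU ?dis5 // s34 //.
  have : 3 * #|G5| <= \sum_(x in G5) #|nbrs adj H x|.
    by rewrite mulnC -sum_nat_const; apply: leq_sum => x /G5P[].
  have := leU (L3 :|: L4) G5; have := leU L3 L4; clear; lia.
have B2 : s3 + 4 * #|L4| + 3 * #|G5| + 5 * #|U| <= 2 * (#|L3| + #|L4| + (#|G5| + #|U|) + (#|H| + #|W|)).
  have disH : [disjoint (L3 :|: L4) :|: (G5 :|: U) & H :|: W].
    apply: disP => v vX; apply: low_H; move: vX; rewrite in_setU => /orP[/low_L34/leq_trans->//|].
    by rewrite in_setU => /orP[/G5P[->]|/UP[->]].
  have disGU : [disjoint G5 & U].
    by apply: disP => v vG; apply/negP => /UP[_]; rewrite vG.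
  have := evenly_drawable_bipartite drawn disH.
  rewrite sum_setU; last by rewrite dis5 // subUset GL5.
  rewrite s34 ?subsetUl // sum_setU //.
  have : 3 * #|G5| <= \sum_(x in G5) #|nbrs adj (H :|: W) x|.
    rewrite mulnC -sum_nat_const; apply: leq_sum => x /G5P[_ /leq_trans]; apply.
    apply/subset_leq_card/subsetP => y; rewrite !in_nbrs in_setU => /andP[-> ->].
    by rewrite orTb.
  have : 5 * #|U| <= \sum_(x in U) #|nbrs adj (H :|: W) x|.
    rewrite mulnC -sum_nat_const; apply: leq_sum => x xU.
    by rewrite in_all ?(proj1 (UP x xU)) // => y; apply: UHW.
  have := leU (L3 :|: L4) (G5 :|: U); have := leU L3 L4; have := leU G5 U; have := leU H W.
  clear; lia.
have cL5 : #|L5| = #|G5| + #|U|.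
  by rewrite -(cardsID G5 L5); congr (#|pred_of_set _| + _); apply/setIidPr/subsetP => v; rewrite inE => /andP[].
move: I1 I2 alt8 B1 B2; rewrite cL5.
move: #|S| #|W| #|H| #|L4| #|G5| #|U| #|L3| => n w h n4 g n5 n3.
move: (\sum_(v in S) deg v) => D; clear; lia.
Qed.

End Counting.

From mathcomp Require Import all_classical all_reals all_analysis.
Import Order.TTheory GRing.Theory Num.Theory.
Import numFieldNormedType.Exports.

(** * From plane drawings to even drawings *)

Section Crossings.
Variable R : realDomainType.
Local Open Scope ring_scope.
Implicit Types u v : R * R.

(** The upper half-plane, with half of the horizontal axis added so that a
    nonzero vector or its opposite, but not both, is positive. *)
Definition lexpos u : bool := (0 < u.2) || (u.2 == 0) && (0 < u.1).

(** For u and v in a common half-plane bounded by a coordinate axis, this is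
    whether the segment uv crosses the negative horizontal axis. *)
Definition crossing u v : bool := (lexpos u (+) lexpos v) && (u.1 < 0).

(** The four open half-planes bounded by a coordinate axis; every nonzero vector
    is in one of them, and [crossing] is a coboundary on each. *)
Definition halfplane (h : bool * bool) u : bool :=
  let c := if h.1 then u.1 else u.2 in if h.2 then 0 < c else c < 0.

Lemma lexposN u : u != 0 -> lexpos (- u) = ~~ lexpos u.
Proof.
case: u => a b; rewrite -pair_eqE /= /pair_eq /= /lexpos /= !oppr_gt0 oppr_eq0.
by case: (ltgtP b 0) => b0; case: (ltgtP a 0) => a0; rewrite ?b0 ?a0 ?eqxx.
Qed.

Lemma crossing_cocycle h u1 u2 u3 u4 :
  halfplane h u1 -> halfplane h u2 -> halfplane h u3 -> halfplane h u4 ->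
  crossing u1 u2 (+) crossing u3 u4 = crossing u1 u3 (+) crossing u2 u4.
Proof.
case: h u1 u2 u3 u4 => [[] []] [a1 b1] [a2 b2] [a3 b3] [a4 b4];
  rewrite /halfplane /crossing /lexpos /= => h1 h2 h3 h4.
- by rewrite !(ltNge _ 0) !(ltW h1, ltW h2, ltW h3, ltW h4) /= !andbF.
- rewrite h1 h2 h3 !andbT.
  by do 4!case: (_ || _).
- by rewrite h1 h2 h3 h4.
- rewrite !(ltNge 0) !(ltW h1, ltW h2, ltW h3, ltW h4) /=.
  by rewrite !(lt_eqF h1, lt_eqF h2, lt_eqF h3, lt_eqF h4).
Qed.

(** Crossings of the positive horizontal axis, which are those of the negative
    one for the opposite vectors, differ by the changes of [lexpos]. *)
Lemma crossingN h u v : halfplane h u -> halfplane h v ->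
  crossing (- u) (- v) = crossing u v (+) (lexpos u (+) lexpos v).
Proof.
have nz w : halfplane h w -> w != 0.
  case: h w => [[] []] [a b]; rewrite /halfplane -pair_eqE /= /pair_eq /= => h;
  by rewrite ?(gt_eqF h) ?(lt_eqF h) ?andbF.
move=> hu hv; have [nu nv] := (nz u hu, nz v hv).
rewrite /crossing !lexposN //; case: h hu hv {nz} => [[] []]; case: u nu => a b nu; case: v nv => c d nv;
  rewrite /halfplane /= => hu hv.
- by rewrite oppr_lt0 hu (ltNge a) ltW //= !andbT andbF; do 2!case: (lexpos _).
- by rewrite oppr_lt0 hu (ltNge 0) ltW //= !andbT andbF; do 2!case: (lexpos _).
- by rewrite /lexpos /= hu hv.
- by rewrite /lexpos /= (lt_gtF hu) (lt_gtF hv) (lt_eqF hu) (lt_eqF hv).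
Qed.

(** A discrete Stokes theorem: the cells contribute nothing, hence neither does
    the boundary of the grid. *)
Lemma crossing_grid (N : nat) (phi : nat -> nat -> R * R) :
  (forall i j, (i < N)%N -> (j < N)%N -> exists h,
     [/\ halfplane h (phi i j), halfplane h (phi i.+1 j),
         halfplane h (phi i j.+1) & halfplane h (phi i.+1 j.+1)]) ->
  \big[addb/false]_(i < N) crossing (phi i 0) (phi i.+1 0)
  (+) \big[addb/false]_(i < N) crossing (phi i N) (phi i.+1 N)
  = \big[addb/false]_(j < N) crossing (phi 0 j) (phi 0 j.+1)
    (+) \big[addb/false]_(j < N) crossing (phi N j) (phi N j.+1).
Proof.
move=> cell.
have row j : (j < N)%N -> forall n, (n <= N)%N ->
    \big[addb/false]_(i < n) crossing (phi i j) (phi i.+1 j)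
    (+) \big[addb/false]_(i < n) crossing (phi i j.+1) (phi i.+1 j.+1)
    = crossing (phi 0 j) (phi 0 j.+1) (+) crossing (phi n j) (phi n j.+1).
  move=> jN; elim=> [|n IHn] nN; first by rewrite !big_ord0 !addbb.
  have [h [h1 h2 h3 h4]] := cell n j nN jN.
  rewrite !big_ord_recr /= addbACA IHn 1?ltnW // (crossing_cocycle h1 h2 h3 h4).
  by rewrite addbA addbK.
suff col n : (n <= N)%N ->
    \big[addb/false]_(i < N) crossing (phi i 0) (phi i.+1 0)
    (+) \big[addb/false]_(i < N) crossing (phi i n) (phi i.+1 n)
    = \big[addb/false]_(j < n) crossing (phi 0 j) (phi 0 j.+1)
      (+) \big[addb/false]_(j < n) crossing (phi N j) (phi N j.+1).
  exact: col.
elim: n => [|n IHn] nN; first by rewrite !big_ord0 !addbb.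
rewrite !big_ord_recr /= addbACA -IHn 1?ltnW // -(row n) //.
by rewrite addbA addbK.
Qed.

Lemma lexpos_telescope (N : nat) (psi : nat -> R * R) :
  \big[addb/false]_(i < N) (lexpos (psi i) (+) lexpos (psi i.+1))
  = lexpos (psi 0) (+) lexpos (psi N).
Proof.
elim: N => [|N IHN]; first by rewrite big_ord0 addbb.
by rewrite big_ord_recr /= IHN addbA addbK.
Qed.

End Crossings.

Section FineGrids.
Variable R : realType.
Local Open Scope classical_set_scope.
Local Open Scope ring_scope.

Lemma within_itv_near (f : R -> R) (s e : R) :
  {within `[0, 1], continuous f} -> s \in `[0, 1] -> 0 < e ->
  exists2 d : R, 0 < d & forall s', s' \in `[0, 1] -> `|s' - s| < d -> `|f s' - f s| < e.
Proof.
move=> /subspace_continuousP cf s01 e0.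
have := cf s s01 => /cvgrPdist_lt/(_ e e0).
rewrite /= near_withinE => /nbhs_ballP[d d0 H]; exists d => // s' s'01 ss'.
rewrite distrC; apply: H => //=; rewrite /ball /= distrC //.
Qed.

Lemma separated_near (f g : R -> R) (s t : R) :
  {within `[0, 1], continuous f} -> {within `[0, 1], continuous g} ->
  s \in `[0, 1] -> t \in `[0, 1] -> f s < g t ->
  exists2 d : R, 0 < d & forall s' t' : R, s' \in `[0, 1] -> t' \in `[0, 1] ->
    `|s' - s| < d -> `|t' - t| < d -> f s' < g t'.
Proof.
move=> cf cg s01 t01 fg.
have e0 : 0 < (g t - f s) / 2 by rewrite divr_gt0 // subr_gt0.
have [d1 d1_gt0 H1] := within_itv_near cf s01 e0.
have [d2 d2_gt0 H2] := within_itv_near cg t01 e0.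
exists (Num.min d1 d2); first by rewrite lt_min d1_gt0.
move=> s' t' s'01 t'01; rewrite !lt_min => /andP[ss' _] /andP[_ tt'].
have := H1 s' s'01 ss'; have := H2 t' t'01 tt'.
rewrite !ltr_norml => /andP[+ _] /andP[_]; lra.
Qed.

Lemma halfplane_near (c1 c2 : R -> R * R) (s t : R) :
  {within `[0, 1], continuous c1} -> {within `[0, 1], continuous c2} ->
  s \in `[0, 1] -> t \in `[0, 1] -> c1 s != c2 t ->
  exists (h : bool * bool) (d : R), 0 < d /\ forall s' t' : R,
    s' \in `[0, 1] -> t' \in `[0, 1] ->
    `|s' - s| < d -> `|t' - t| < d -> halfplane h (c2 t' - c1 s').
Proof.
move=> cc1 cc2 s01 t01 ne.
have cfst (c : R -> R * R) : {within `[0, 1], continuous c} -> {within `[0, 1], continuous (fst \o c)}.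
  by move=> cc x; apply: (cvg_comp _ _ (cc x)); exact: cvg_fst.
have csnd (c : R -> R * R) : {within `[0, 1], continuous c} -> {within `[0, 1], continuous (snd \o c)}.
  by move=> cc x; apply: (cvg_comp _ _ (cc x)); exact: cvg_snd.
have : ((c1 s).1 != (c2 t).1) || ((c1 s).2 != (c2 t).2).
  by rewrite -negb_and; apply: contra ne => /andP[/eqP E1 /eqP E2]; rewrite [c1 s]surjective_pairing E1 E2 -surjective_pairing.
rewrite /halfplane !neq_lt => /orP[/orP[]|/orP[]] lt12.
- have [d d0 H] := separated_near (cfst _ cc1) (cfst _ cc2) s01 t01 lt12.
  by exists (true, true), d; split=> // s' t' *; rewrite /= subr_gt0; apply: H.
- have [d d0 H] := separated_near (cfst _ cc2) (cfst _ cc1) t01 s01 lt12.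
  by exists (true, false), d; split=> // s' t' *; rewrite /= subr_lt0; apply: H.
- have [d d0 H] := separated_near (csnd _ cc1) (csnd _ cc2) s01 t01 lt12.
  by exists (false, true), d; split=> // s' t' *; rewrite /= subr_gt0; apply: H.
- have [d d0 H] := separated_near (csnd _ cc2) (csnd _ cc1) t01 s01 lt12.
  by exists (false, false), d; split=> // s' t' *; rewrite /= subr_lt0; apply: H.
Qed.

(** Lebesgue's number for the cover of the square by the preimages of the four
    half-planes under the difference of the two curves. *)
Lemma fine_grid (c1 c2 : R -> R * R) :
  {within `[0, 1], continuous c1} -> {within `[0, 1], continuous c2} ->
  (forall s t : R, s \in `[0, 1] -> t \in `[0, 1] -> c1 s != c2 t) ->
  \forall N \near \oo, forall s t : R, s \in `[0, 1] -> t \in `[0, 1] ->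
    exists h, forall s' t' : R, s' \in `[0, 1] -> t' \in `[0, 1] ->
      `|s' - s| <= N.+1%:R^-1 -> `|t' - t| <= N.+1%:R^-1 -> halfplane h (c2 t' - c1 s').
Proof.
move=> cc1 cc2 ne.
have K : compact (`[0, 1]%classic `*` `[0, 1]%classic : set (R * R)).
  by apply: compact_setX; exact: segment_compact.
pose P (N : nat) (x : R * R) := exists h, forall s' t' : R, s' \in `[0, 1] -> t' \in `[0, 1] ->
      `|s' - x.1| <= N.+1%:R^-1 -> `|t' - x.2| <= N.+1%:R^-1 -> halfplane h (c2 t' - c1 s').
have cover (x : R * R) : (`[0, 1]%classic `*` `[0, 1]%classic : set (R * R)) x -> \forall x' \near x & N \near \oo, P N x'.
  move=> [x1 x2]; have [h [d [d0 H]]] := halfplane_near cc1 cc2 x1 x2 (ne _ _ x1 x2).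
  have d20 : 0 < d / 2 by rewrite divr_gt0.
  exists (ball x (d / 2), [set N | N.+1%:R^-1 < d / 2]).
    split; first exact: nbhsx_ballx.
    exact: (near_infty_natSinv_lt (PosNum d20)).
  move=> [x' N] /= [[b1 b2] Nd]; exists h => s' t' s'01 t'01 ss' tt'.
  have {}Nd : N.+1%:R^-1 < d / 2 :> R := Nd.
  have {}b1 : `|x.1 - x'.1| < d / 2 := b1.
  have {}b2 : `|x.2 - x'.2| < d / 2 := b2.
  move: (N.+1%:R^-1 : R) Nd ss' tt' => r rd ss' tt'.
  apply: H => //.
    have -> : s' - x.1 = (s' - x'.1) - (x.1 - x'.1) by lra.
    apply: le_lt_trans (ler_normB _ _) _; move: ss' b1 rd; clear.
    move: (`|s' - x'.1|) (`|x.1 - x'.1|) => a b; lra.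
  have -> : t' - x.2 = (t' - x'.2) - (x.2 - x'.2) by lra.
  apply: le_lt_trans (ler_normB _ _) _; move: tt' b2 rd; clear.
  move: (`|t' - x'.2|) (`|x.2 - x'.2|) => a b; lra.
have all_cells := iffLR (compact_near_coveringP _) K nat \oo P _ cover.
near=> N => s t s01 t01.
have cells : (`[0, 1]%classic `*` `[0, 1]%classic : set (R * R)) `<=` P N by near: N; exact: all_cells.
exact: (cells (s, t)).
Unshelve. all: by end_near.
Qed.

End FineGrids.

Section DrawingParity.
Variables (R : realType) (G : sgraph) (p : G -> R * R) (g : edge G -> R -> R * R).
Local Open Scope classical_set_scope.
Local Open Scope ring_scope.
Hypothesis drawn : plane_drawing p g.

(** Disjoint edges have disjoint closed curves, ends included. *)
Lemma edge_curves_disjoint (e f : edge G) (s t : R) :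
  (forall u, ~~ (incident u e && incident u f)) ->
  s \in `[0, 1] -> t \in `[0, 1] -> g e s != g f t.
Proof.
case: drawn => p_inj _ ends no_vertex no_cross ef.
have ef_ne : e != f.
  apply/eqP => E; move: (valP e); rewrite /edge_set => /imset2P[u v uG _ Ee].
  by have := ef u; rewrite -E andbb /incident Ee !inE eqxx.
have end0 (e' : edge G) : exists2 u, incident u e' & g e' 0 = p u.
  have : [set g e' 0; g e' 1] (g e' 0) by left.
  by rewrite ends => -[u /= ue E]; exists u.
have end1 (e' : edge G) : exists2 u, incident u e' & g e' 1 = p u.
  have : [set g e' 0; g e' 1] (g e' 1) by right.
  by rewrite ends => -[u /= ue E]; exists u.
have pts (e' : edge G) (r : R) : r \in `[0, 1] -> (r \in `]0, 1[) \/ exists2 u, incident u e' & g e' r = p u.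
  rewrite !in_itv /= => /andP[]; rewrite !le_eqVlt.
  case/orP=> [/eqP <- _|r0]; first by right.
  by case/orP=> [/eqP ->|r1]; [right | left; rewrite r0 r1].
move=> s01 t01; apply/eqP => E.
case: (pts e s s01) (pts f t t01) => [si|[u ue Eu]] [ti|[v vf Ev]].
- exact: (no_cross e f s t ef_ne si ti).
- by apply: (no_vertex e v s si); rewrite E.
- by apply: (no_vertex f u t ti); rewrite -E.
- have uv : u = v by apply: p_inj; rewrite -Eu -Ev.
  by have := ef u; rewrite ue uv vf.
Qed.

Lemma grid_subdivision : exists2 N : nat, (0 < N)%N & forall (e f : edge G),
  (forall u, ~~ (incident u e && incident u f)) ->
  forall i j, (i < N)%N -> (j < N)%N -> exists h, forall i' j',
    (i' = i \/ i' = i.+1)%N -> (j' = j \/ j' = j.+1)%N ->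
    halfplane h (g f (j'%:R / N%:R) - g e (i'%:R / N%:R)).
Proof.
have : \forall N \near \oo, forall e f : edge G,
  (forall u, ~~ (incident u e && incident u f)) -> forall s t : R, s \in `[0, 1] -> t \in `[0, 1] ->
    exists h, forall s' t' : R, s' \in `[0, 1] -> t' \in `[0, 1] ->
      `|s' - s| <= N.+1%:R^-1 -> `|t' - t| <= N.+1%:R^-1 -> halfplane h (g f t' - g e s').
  apply: filter_forall => e; apply: filter_forall => f.
  have [ef|nef] := pselect (forall u, ~~ (incident u e && incident u f)); last first.
    by apply: nearW => N /nef.
  case: drawn => _ cont _ _ _.
  have := fine_grid (proj1 (cont e)) (proj1 (cont f)) (fun s t => @edge_curves_disjoint e f s t ef).
  by apply: filterS => N H _.
move=> /filter_ex[N HN]; exists N.+1 => // e f ef i j iN jN.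
have in01 k : (k <= N.+1)%N -> (k%:R / N.+1%:R : R) \in `[0, 1].
  move=> kN; rewrite in_itv /= divr_ge0 //= ler_pdivrMr ?ltr0n // mul1r ler_nat //.
have close k k' : k' = k \/ k' = k.+1 -> `|k'%:R / N.+1%:R - k%:R / N.+1%:R : R| <= N.+1%:R^-1.
  case=> ->; first by rewrite subrr normr0 invr_ge0.
  by rewrite -mulrBl -natrB // subSnn mul1r ger0_norm // invr_ge0.
have le1 k k' : (k < N.+1)%N -> k' = k \/ k' = k.+1 -> (k' <= N.+1)%N.
  by move=> kN [->|->] //; apply: ltnW.
have [h Hh] := HN e f ef _ _ (in01 i (ltnW iN)) (in01 j (ltnW jN)).
exists h => i' j' Hi Hj; apply: Hh; [| |exact: close|exact: close].
- by apply: in01; exact: le1 Hi.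
- by apply: in01; exact: le1 Hj.
Qed.

Lemma edge_ends (e : edge G) (a b : G) : val e = [set a; b]%SET -> a != b ->
  (g e 0 = p a /\ g e 1 = p b) \/ (g e 0 = p b /\ g e 1 = p a).
Proof.
move=> Ee ab; case: drawn => p_inj _ ends _ _.
have inc u : u \in [set a; b]%SET -> p u = g e 0 \/ p u = g e 1.
  move=> uab; have : [set p u | u in [set u | incident u e]] (p u).
    by exists u => //=; rewrite /incident Ee.
  by rewrite -ends.
have pab : p a <> p b by move/p_inj/eqP; rewrite (negPf ab).
have ha : a \in [set a; b]%SET by rewrite !inE eqxx.
have hb : b \in [set a; b]%SET by rewrite !inE eqxx orbT.
by case: (inc a ha) (inc b hb) => Ea [] Eb; [case: pab; rewrite Ea Eb|left|right|case: pab; rewrite Ea Eb].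
Qed.

Lemma edge_of_adj (a b : G) : adj a b -> exists e : edge G, val e = [set a; b]%SET.
Proof.
move=> ab; have abE : [set a; b]%SET \in edge_set G.
  by apply/imset2P; exists a b; rewrite // inE.
by exists (exist (fun e : {set G} => e \in edge_set G) _ abE).
Qed.

(** The parity of an edge e seen from a vertex counts crossings along a fine
    subdivision of the curve of e.  For disjoint edges the difference of their
    curves maps the grid off the origin; its four sides carry the four parities,
    two of them for opposite vectors, which brings in the comparisons. *)
Lemma adj_evenly_drawable : evenly_drawable (@adj G).
Proof.
have [N N_gt0 grid] := grid_subdivision.
split; [exact: adj_sym | exact: adj_irrefl |].
pose pt (e : edge G) (i : nat) : R * R := g e (i%:R / N%:R).
pose wind (a : G) (e : edge G) := \big[addb/false]_(k < N) crossing (pt e k - p a) (pt e k.+1 - p a).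
pose lt (a b : G) := lexpos (p a - p b).
have [p_inj _ _ _ _] := drawn.
have ltN a b : a != b -> lt a b = ~~ lt b a.
  move=> ab; rewrite /lt -lexposN; first by rewrite opprB.
  by rewrite subr_eq0; apply: contra ab => /eqP/p_inj->.
have pt0 e : pt e 0 = g e 0 by rewrite /pt mul0r.
have ptN e : pt e N = g e 1 by rewrite /pt divff // pnatr_eq0 -lt0n.
have parity e f a b c d : (forall u, ~~ (incident u e && incident u f)) ->
    uniq [:: a; b; c; d] ->
    g e 0 = p a -> g e 1 = p b -> g f 0 = p c -> g f 1 = p d ->
    wind a f (+) wind b f (+) wind c e (+) wind d e
    = lt a c (+) lt a d (+) lt b c (+) lt b d.
  move=> ef; rewrite /= !inE !negb_or !andbT => /and3P[/and3P[nab nac nad] /andP[nbc nbd] ncd].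
  move=> e0 e1 f0 f1; pose phi i j := pt f j - pt e i.
  have cell i j : (i < N)%N -> (j < N)%N -> exists h,
     [/\ halfplane h (phi i j), halfplane h (phi i.+1 j),
         halfplane h (phi i j.+1) & halfplane h (phi i.+1 j.+1)].
    move=> iN jN; have [h Hh] := grid e f ef i j iN jN; exists h.
    by split; apply: Hh; by [left|right].
  have stokes := crossing_grid cell.
  have along_e j z : (j = 0 \/ j = N) -> pt f j = p z ->
      wind z e = \big[addb/false]_(i < N) crossing (phi i j) (phi i.+1 j) (+) (lt z a (+) lt z b).
    move=> Hj ptj; have -> : lt z a (+) lt z b = lexpos (phi 0 j) (+) lexpos (phi N j).
      by rewrite /phi ptj pt0 ptN e0 e1.
    rewrite -(lexpos_telescope N (fun i => phi i j)) -big_split /=.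
    apply: eq_bigr => i _; rewrite -ptj -[pt e i - _]opprB -[pt e i.+1 - _]opprB.
    case: Hj => Ej.
      have [h [h1 h2 _ _]] := cell i 0 (ltn_ord i) N_gt0.
      by rewrite Ej (crossingN h1 h2).
    have N1 : N.-1.+1 = N by rewrite prednK.
    have [h [_ _ ]] := cell i N.-1 (ltn_ord i) (ltac:(by rewrite -[X in (_ < X)%N]N1)).
    by rewrite N1 Ej => h1 h2; rewrite (crossingN h1 h2).
  rewrite (along_e 0 c) ?(along_e N d) ?pt0 ?ptN //; [|by right|by left].
  have -> : wind a f = \big[addb/false]_(j < N) crossing (phi 0 j) (phi 0 j.+1).
    by rewrite /wind /phi pt0 e0.
  have -> : wind b f = \big[addb/false]_(j < N) crossing (phi N j) (phi N j.+1).
    by rewrite /wind /phi ptN e1.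
  rewrite -stokes (ltN c a) 1?eq_sym // (ltN c b) 1?eq_sym // (ltN d a) 1?eq_sym // (ltN d b) 1?eq_sym //.
  by do 2!case: (\big[_/_]_(_ < _) _); do 4!case: (lt _ _).
pose n (a u v : G) := if insub [set u; v]%SET is Some e then wind a e else false.
exists lt, n; split=> // [a u v|a b c d U ab cd]; first by rewrite /n finset.setUC.
have [e Ee] := edge_of_adj ab; have [f Ef] := edge_of_adj cd.
have nE z : n z a b = wind z e by rewrite /n -Ee valK.
have nF z : n z c d = wind z f by rewrite /n -Ef valK.
rewrite !nE !nF.
have ef u : ~~ (incident u e && incident u f).
  rewrite /incident Ee Ef !inE; move: U; rewrite /= !inE !negb_or !andbT.
  case/and3P=> /and3P[nab nac nad] /andP[nbc nbd] ncd.
  by apply/negP => /andP[/orP[]/eqP-> /orP[]]; apply/negP.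
move: (U); rewrite /= !inE !negb_or !andbT => /and3P[/and3P[nab nac nad] /andP[nbc nbd] ncd].
have := edge_ends Ee nab; have := edge_ends Ef ncd.
have U1 : uniq [:: b; a; c; d] by rewrite /= !inE !negb_or (eq_sym b) nab nac nad nbc nbd ncd.
have U2 : uniq [:: a; b; d; c] by rewrite /= !inE !negb_or (eq_sym d) nab nac nad nbc nbd ncd.
have U3 : uniq [:: b; a; d; c] by rewrite /= !inE !negb_or (eq_sym d) (eq_sym b) nab nac nad nbc nbd ncd.
case=> -[f0 f1] [] [e0 e1].
- exact: parity.
- by rewrite [LHS](ACl (2*1*3*4)) [RHS](ACl (3*4*1*2)); apply: parity.
- by rewrite [LHS](ACl (1*2*4*3)) [RHS](ACl (2*1*4*3)); apply: parity.
- by rewrite [LHS](ACl (2*1*4*3)) [RHS](ACl (4*3*2*1)); apply: parity.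
Qed.

End DrawingParity.

(** * The (2,1)-total labelling number *)

Lemma far_dist (a b : nat) : far a b -> (2 <= `|a - b|)%N.
Proof. by rewrite /far; lia. Qed.

Lemma labellable_total (G : sgraph) (k : nat) :
  labellable k.+2 (@adj G) -> total_labellable G k.+1.
Proof.
case=> vc [ec [okv oks oke okf]]; apply/andP; split=> //.
have endsP (e : edge G) : exists2 p : G * G, adj p.1 p.2 & val e = [set p.1; p.2]%SET.
  by have /imset2P[u v _ + ->] := valP e; rewrite inE => uv; exists (u, v).
pose lab (e : edge G) : 'I_k.+2 :=
  if [pick p : G * G | adj p.1 p.2 && (val e == [set p.1; p.2]%SET)] is Some p
  then ec p.1 p.2 else ord0.
have labE (e : edge G) u v : adj u v -> val e = [set u; v]%SET -> lab e = ec u v.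
  move=> uv Ee; rewrite /lab; case: pickP => [[a b] /= /andP[ab]|/(_ (u, v))]; last first.
    by rewrite /= uv Ee eqxx.
  have nuv : u != v by apply: contraTneq uv => ->; rewrite adj_irrefl.
  rewrite Ee => /eqP/finset.setP E.
  have := E u; have := E v; rewrite !inE !eqxx orbT /=.
  case/esym/orP=> /eqP Ev /esym/orP[] /eqP Eu; subst=> //; rewrite ?eqxx // in nuv *.
  exact: oks.
have incE (e : edge G) u : incident u e -> exists2 v, adj u v & val e = [set u; v]%SET.
  rewrite /incident; have [[a b] /= ab ->] := endsP e; rewrite !inE => /orP[] /eqP->.
    by exists b.
  by exists a; [rewrite adj_sym | rewrite finset.setUC].
apply/existsP; exists [ffun x => match x with inl u => vc u | inr e => lab e end].
apply/and3P; split.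
- by apply/forallP => u; apply/forallP => v; apply/implyP => uv; rewrite !ffunE; apply: okv.
- apply/forallP => e; apply/forallP => f; apply/implyP => /andP[ef /existsP[u /andP[ue uf]]].
  have [v uv Ev] := incE e u ue; have [w uw Ew] := incE f u uf.
  rewrite !ffunE (labE e u v) // (labE f u w) //; apply: oke => //.
  by apply: contra ef => /eqP vw; apply/eqP/val_inj; rewrite Ev Ew vw.
- apply/forallP => u; apply/forallP => e; apply/implyP => ue; rewrite !ffunE.
  have [v uv Ev] := incE e u ue; rewrite (labE e u v) //.
  exact: far_dist (okf u v uv).
Qed.

Theorem theorem1p6 (R : realType) (M : nat) (G : sgraph) :
  (12 <= M)%N -> planar R G -> (max_degree G <= M)%N ->
  (total_labelling_number G <= M + 2)%N /\
  (M = max_degree G -> (total_labelling_number G <= max_degree G + 2)%N).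
Proof.
move=> M12 [p [g drawn]] max_M.
suff le_M2 : (total_labelling_number G <= M + 2)%N by split=> // <-.
have deg_le u : (#|nbrs (@adj G) [set: G]%SET u| <= M)%N.
  apply: leq_trans max_M; apply: leq_trans (leq_bigmax u).
  by apply: subset_leq_card; apply/fintype.subsetP => v; rewrite !inE.
have := evenly_drawable_labellable M12 (adj_evenly_drawable drawn) deg_le.
move=> /labellable_total lab; rewrite addn2 /total_labelling_number.
by case: ex_minnP => k _; apply.
Qed.
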